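(* Let $k$ be a field of characteristic $\ne 2$, let $Q$ be a quaternion $k$-algebra, and let $\mathrm{SL}(Q)$ be the algebraic group whose $k$-points are the norm-one elements of $Q$. Let $n$ be a positive even integer and let $V(n)$ be the Weyl module with highest weight $n\omega$ (which is defined over $k$ as a representation of $\mathrm{SL}(Q)$). Then there is an $\mathrm{SL}(Q)$-invariant symmetric bilinear form on $V(n)$ that is isomorphic to \[ \langle 2 \rangle \cdot \phi^{\mathrm{odd}}_n \cdot Q \;\oplus\; \begin{cases} \left\langle\binom{n}{n/2}\right\rangle & \text{if } n \equiv 0 \bmod 4,\\[2pt] \left\langle\binom{n}{n/2}\right\rangle Q' & \text{if } n \equiv 2 \bmod 4. \end{cases} \]
   Context: For $\lambda \in k$, $\langle \lambda \rangle$ denotes a one-dimensional $k$-vector space with basis $e$ and symmetric bilinear form $(e,e)\mapsto \lambda$ (possibly degenerate if $\lambda=0$ in $k$); $\oplus$ is orthogonal sum and juxtaposition/$\cdot$ is tensor product of symmetric bilinear forms. Define $\phi^{\mathrm{odd}}_n := \bigoplus_{0 \le i < n/2,\ i \text{ odd}} \langle \binom{n}{i} \rangle$ (binomial coefficients viewed in $k$). Symmetric bilinear forms are identified with quadratic forms via $b \mapsto (v\mapsto b(v,v))$. $Q$ also denotes the (quadratic) norm form of $Q$, and $Q'$ is the unique 3-dimensional quadratic form with $Q \cong \langle 1\rangle \oplus Q'$. $\omega$ is the fundamental dominant weight of $\mathrm{SL}_2$; $V(n)$ is the Weyl module for $\mathrm{SL}_2$ of highest weight $n\omega$, and for $n$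 even it descends (by Galois descent) to a $k$-representation of the twisted form $\mathrm{SL}(Q)$. *)

(* Defs.v *)
From HB Require Import structures.
From mathcomp Require Import all_boot all_order all_algebra.
From mathcomp Require Import mpoly.
Set Implicit Arguments. Unset Strict Implicit. Unset Printing Implicit Defensive.
Import Order.TTheory GRing.Theory.
Local Open Scope ring_scope.

(* Quaternion algebra (a,b)_S over a commutative ring S, basis 1,i,j,ij     *)
(* with i^2 = a, j^2 = b, ij = -ji.  A quaternion is a 4-tuple of coords.   *)
Definition quat (S : Type) := (S * S * S * S)%type.

Definition qmul (S : comNzRingType) (a b : S) (x y : quat S) : quat S :=
  let: (x0, x1, x2, x3) := x in
  let: (y0, y1, y2, y3) := y in
  (x0 * y0 + a * x1 * y1 + b * x2 * y2 - a * b * x3 * y3,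
   x0 * y1 + x1 * y0 - b * x2 * y3 + b * x3 * y2,
   x0 * y2 + x2 * y0 + a * x1 * y3 - a * x3 * y1,
   x0 * y3 + x3 * y0 + x1 * y2 - x2 * y1).

Definition qconj (S : comNzRingType) (x : quat S) : quat S :=
  let: (x0, x1, x2, x3) := x in (x0, - x1, - x2, - x3).

(* reduced norm  N(x) = x * qconj x *)
Definition qnorm (S : comNzRingType) (a b : S) (x : quat S) : S :=
  let: (x0, x1, x2, x3) := x in
  x0 ^+ 2 - a * x1 ^+ 2 - b * x2 ^+ 2 + a * b * x3 ^+ 2.

(* Functor of points of SL(Q): for a commutative k-algebra R, SL(Q)(R) is   *)
(* the set of g in Q (x) R with N(g) = 1.                                   *)
Definition in_SLQ (k : fieldType) (a b : k) (R : comAlgType k) (g : quat R) :=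
  qnorm (a%:A) (b%:A) g = 1.

(* Coordinates x,y,z on the pure quaternions Q' (q = x i + y j + z ij).     *)
(* The 3 linear forms giving the coordinates of  conj(g) * q * g  (which is *)
(* g^{-1} q g for g in SL(Q)) : the contragredient (function) action of g on *)
(* polynomial functions on Q' is  p |-> p \mPo (adjt g).                     *)
Definition adjt (k : fieldType) (a b : k) (R : comAlgType k) (g : quat R)
  : 3.-tuple {mpoly R[3]} :=
  let C := fun r : R => r%:MP_[3] in
  let: (g0, g1, g2, g3) := g in
  let G : quat {mpoly R[3]} := (C g0, C g1, C g2, C g3) in
  let q : quat {mpoly R[3]} := (0, 'X_(0 : 'I_3), 'X_(1 : 'I_3), 'X_(2 : 'I_3)) in
  let A := C (a%:A) in let B := C (b%:A) in
  let: (_, r1, r2, r3) := qmul A B (qmul A B (qconj G) q) G in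
  [tuple r1; r2; r3].

Definition Npoly (k : fieldType) (a b : k) (R : comAlgType k) : {mpoly R[3]} :=
  let C := fun r : R => r%:MP_[3] in
  qnorm (C (a%:A)) (C (b%:A)) (0, 'X_(0 : 'I_3), 'X_(1 : 'I_3), 'X_(2 : 'I_3)).

(* H^0(2m) for SL(Q): the degree-m part of the homogeneous coordinate ring  *)
(* k[x,y,z]/(N) of the Severi-Brauer conic {N = 0} in P(Q'), with SL(Q)     *)
(* acting through conjugation on Q'.  Its basis (modulo N, x^2 can be       *)
(* eliminated since a is invertible) consists of the 2m+1 monomials         *)
(*     y^(m-i) z^i  (0 <= i <= m)   and   x y^(m-1-i) z^i  (0 <= i < m).     *)
Definition hbasis (R : comNzRingType) (m : nat) (i : 'I_(m.*2.+1)) : {mpoly R[3]} :=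
  if (i <= m)%N then
    'X_(1 : 'I_3) ^+ (m - i) * 'X_(2 : 'I_3) ^+ i
  else
    'X_(0 : 'I_3) * 'X_(1 : 'I_3) ^+ (m.-1 - (i - m.+1)) * 'X_(2 : 'I_3) ^+ (i - m.+1).

Definition action_matrix (k : fieldType) (a b : k) (R : comAlgType k) (m : nat)
  (g : quat R) (A : 'M[R]_(m.*2.+1)) : Prop :=
  forall j : 'I_(m.*2.+1),
    exists c : {mpoly R[3]},
      hbasis R j \mPo adjt a b g - \sum_i A i j *: hbasis R i = c * Npoly a b R.

(* V(2m) := H^0(2m)^* (Weyl module).  A bilinear form on V(2m) is given by its *)
(* Gram matrix G in the basis dual to hbasis; equivalently by the tensor       *)
(* T = sum_{i,j} G i j h_i (x) h_j of H (x) H.  The form is SL(Q)-invariant    *)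
(* (as a form on the representation of the algebraic group, i.e. over every   *)
(* commutative k-algebra R) iff T is invariant under g (x) g for all points g. *)
Definition SLQ_invariant (k : fieldType) (a b : k) (m : nat)
  (G : 'M[k]_(m.*2.+1)) : Prop :=
  forall (R : comAlgType k) (g : quat R) (A : 'M[R]_(m.*2.+1)),
    in_SLQ a b g -> action_matrix a b g A ->
    A *m map_mx (fun c : k => c%:A) G *m A^T = map_mx (fun c : k => c%:A) G.

Definition dform (k : fieldType) (l : seq k) : 'M[k]_(size l) :=
  diag_mx (\row_(i < size l) l`_i).

Definition bf1 (k : fieldType) (l : k) : seq k := [:: l].
Definition bfsum (k : fieldType) (s t : seq k) : seq k := s ++ t.
Definition bftens (k : fieldType) (s t : seq k) : seq k :=
  [seq x * y | x <- s, y <- t].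

Definition phi_odd (k : fieldType) (n : nat) : seq k :=
  flatten [seq bf1 ('C(n, i))%:R | i <- iota 0 n & odd i && (i.*2 < n)%N].

Definition normQ (k : fieldType) (a b : k) : seq k := [:: 1; - a; - b; a * b].
Definition normQ' (k : fieldType) (a b : k) : seq k := [:: - a; - b; a * b].

Definition isometric (k : fieldType) (d d' : nat) (G : 'M[k]_d) (D : 'M[k]_d') : Prop :=
  exists (P : 'M[k]_(d', d)) (P' : 'M[k]_(d, d')),
    P *m P' = 1%:M /\ P' *m P = 1%:M /\ P *m G *m P^T = D.

Definition target_form (k : fieldType) (a b : k) (n : nat) : seq k :=
  bfsum (bftens (bf1 2%:R) (bftens (phi_odd k n) (normQ a b)))
        (if (4 %| n)%N then bf1 ('C(n, n./2))%:R
         else bftens (bf1 ('C(n, n./2))%:R) (normQ' a b)).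

(* Main.v *)
(* Elements of H^0(2m) are functions on the conic N = 0, so an invariant tensor is a
   function of two points p, q of the conic; we take B(p, q)^m, where B is the polar form
   of N. Over k(sqrt a) put w = y + sqrt a z; on the conic a x^2 = - b w w', where w' is
   the conjugate of w, and B(p, q) is a sum of three terms U + V - 2 c with U V = c^2,
   so that B^m expands like (s - t)^(2m). This diagonalizes the tensor on the vectors
   x^i Re (w^(m - i)) and x^i Im (w^(m - i)), with coefficients binomial(2m, i) up to
   units. The terms with i odd already have the required shape. Those with i even are
   moved to odd i by a Krawtchouk matrix: rotating u^2 + v^2 by 45 degrees exchanges the
   characters of (u, v) -> (u, -v) and (u, v) -> (v, u) on (u u' + v v')^(2m), which gives
   an isometry over Z[1/2] from the forms <binomial(2m, i)>, i < m even, to those with i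
   odd, also when some of the binomials vanish in k. *)
Require Import Defs.
From HB Require Import structures.
From mathcomp Require Import all_boot all_order all_algebra ring zify.
From mathcomp Require Import mpoly.
Set Implicit Arguments. Unset Strict Implicit. Unset Printing Implicit Defensive.
Import GRing.Theory Num.Theory.
Local Open Scope ring_scope.

(** Indices [i] and [2m - i] play opposite roles both in the expansion of a [2m]-th power and in the
    weight basis; the middle index is its own partner. *)
Lemma sum_fold (V : nmodType) (m : nat) (F : nat -> V) :
  \sum_(i < m.*2.+1) F i = \sum_(i < m) (F i + F (m.*2 - i)%N) + F m.
Proof.
rewrite -(big_mkord xpredT F); have le_m : (m <= m.*2.+1)%N by lia.
rewrite (big_cat_nat (leq0n _) le_m) /= (@big_ltn _ _ _ m m.*2.+1) /=; last by lia.
rewrite -{1}[m.+1]add0n big_addn (_ : m.*2.+1 - m.+1 = m)%N; last by lia.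
rewrite [X in _ + (_ + X)]big_nat_rev /= addrCA addrC; congr (_ + _).
rewrite !big_mkord -big_split; apply: eq_bigr => i _ /=; congr (_ + F _).
by have := ltn_ord i; lia.
Qed.

(** * Quadratic extensions of commutative rings *)

(* The ring [D[X] / (X^2 - d)]; the pair [(u, v)] stands for [u + v X]. *)
Definition sqext (D : comNzRingType) (d : D) : Type := (D * D)%type.

Section SqExt.
Variables (D : comNzRingType) (d : D).
Implicit Types u v w : sqext d.

HB.instance Definition _ := GRing.Zmodule.copy (sqext d) (D * D)%type.

Definition sqext_one : sqext d := (1, 0).
Definition sqext_mul u v : sqext d :=
  (u.1 * v.1 + d * (u.2 * v.2), u.1 * v.2 + u.2 * v.1).

Fact sqext_mulA : associative sqext_mul.
Proof. by move=> u v w; congr (_, _) => /=; ring. Qed.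
Fact sqext_mulC : commutative sqext_mul.
Proof. by move=> u v; congr (_, _) => /=; ring. Qed.
Fact sqext_mul1 : left_id sqext_one sqext_mul.
Proof. by case=> u v; congr (_, _) => /=; ring. Qed.
Fact sqext_mulDl : left_distributive sqext_mul +%R.
Proof. by move=> u v w; congr (_, _) => /=; ring. Qed.
Fact sqext_one_neq0 : sqext_one != 0.
Proof. by apply/eqP => -[/eqP]; rewrite oner_eq0. Qed.

HB.instance Definition _ := GRing.Zmodule_isComNzRing.Build (sqext d)
  sqext_mulA sqext_mulC sqext_mul1 sqext_mulDl sqext_one_neq0.

Definition sqext_in (c : D) : sqext d := (c, 0).
Definition sqext_root : sqext d := (0, 1).

Fact sqext_in_is_zmod : zmod_morphism sqext_in.
Proof. by move=> u v; congr (_, _) => /=; rewrite ?subr0. Qed.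
Fact sqext_in_is_monoid : monoid_morphism sqext_in.
Proof. by split=> // u v; congr (_, _) => /=; ring. Qed.
HB.instance Definition _ := GRing.isZmodMorphism.Build D (sqext d) sqext_in sqext_in_is_zmod.
HB.instance Definition _ := GRing.isMonoidMorphism.Build D (sqext d) sqext_in sqext_in_is_monoid.

Lemma sqext_inj : injective sqext_in. Proof. by move=> u v []. Qed.

Lemma sqext_rootK : sqext_root ^+ 2 = sqext_in d.
Proof. by congr (_, _) => /=; ring. Qed.

Lemma sqext_eq0 (p q : D) : sqext_in p + sqext_root * sqext_in q = 0 -> p = 0 /\ q = 0.
Proof.
move=> /(congr1 (fun u : sqext d => (u.1, u.2))) /= [].
by rewrite !(mul0r, mulr0, mul1r, addr0, add0r).
Qed.
End SqExt.

(** * Krawtchouk matrices *)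

Lemma size_exp_bound (R : nzSemiRingType) (p : {poly R}) (n e : nat) :
  (size p <= n.+1)%N -> (size (p ^+ e) <= (n * e).+1)%N.
Proof.
move=> le_pn; apply: leq_trans (size_poly_exp_leq _ _) _.
by rewrite ltnS leq_mul2r -[n]/(n.+1.-1) -!subn1 leq_sub2r ?orbT.
Qed.

(** * Homogenization of univariate polynomials *)

Section Homogenization.
Variables (R : comNzRingType) (S : comNzRingType) (phi : {rmorphism R -> S}) (s t : S).
Implicit Types p q : {poly R}.

(** This is [s^n p(t/s)] without division. The degree [n] is explicit because [p] may have smaller
    degree; coefficients beyond [n] are dropped, hence the size bounds in the multiplicativity
    lemmas. *)
Definition homogenize (n : nat) p : S := \sum_(j < n.+1) phi p`_j * (s ^+ (n - j) * t ^+ j).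

Lemma homogenizeD n p q : homogenize n (p + q) = homogenize n p + homogenize n q.
Proof.
rewrite /homogenize -big_split /=; apply: eq_bigr => j _.
by rewrite coefD rmorphD mulrDl.
Qed.

Lemma homogenizeZ n c p : homogenize n (c *: p) = phi c * homogenize n p.
Proof.
rewrite /homogenize mulr_sumr; apply: eq_bigr => j _.
by rewrite coefZ rmorphM -mulrA.
Qed.

Lemma homogenize0 n : homogenize n 0 = 0.
Proof. by rewrite /homogenize big1 // => j _; rewrite coef0 rmorph0 mul0r. Qed.

Lemma homogenize_sum n (I : Type) (r : seq I) (F : I -> {poly R}) :
  homogenize n (\sum_(i <- r) F i) = \sum_(i <- r) homogenize n (F i).
Proof. exact: (big_morph (homogenize n) (@homogenizeD n) (homogenize0 n)). Qed.

Lemma homogenizeXn n i : (i <= n)%N -> homogenize n 'X^i = s ^+ (n - i) * t ^+ i.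
Proof.
move=> le_in; rewrite /homogenize (bigD1 (Ordinal (le_in : (i < n.+1)%N))) //=.
rewrite coefXn eqxx rmorph1 mul1r big1 ?addr0 // => j ne_ji.
rewrite coefXn (negPf (_ : (j != i :> nat))) ?rmorph0 ?mul0r //.
Qed.

Lemma homogenizeM m n p q : (size p <= m.+1)%N -> (size q <= n.+1)%N ->
  homogenize (m + n) (p * q) = homogenize m p * homogenize n q.
Proof.
have expand N (r : {poly R}) : (size r <= N.+1)%N -> r = \sum_(j < N.+1) r`_j *: 'X^j.
  move=> le_rN; rewrite -(poly_def N.+1 (fun j => r`_j)); apply/polyP => i.
  rewrite coef_poly; case: ltnP => // lt_Ni.
  by rewrite nth_default // (leq_trans le_rN).
move=> /expand {1}-> /expand {1}->; rewrite mulr_suml homogenize_sum [RHS]mulr_suml.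
apply: eq_bigr => i _; rewrite mulr_sumr homogenize_sum mulr_sumr.
apply: eq_bigr => j _.
rewrite -scalerAl -scalerAr scalerA -exprD homogenizeZ rmorphM homogenizeXn; last first.
  by rewrite leq_add // -ltnS.
have -> : (m + n - (i + j) = (m - i) + (n - j))%N.
  by have := ltn_ord i; have := ltn_ord j; lia.
by rewrite !exprD; ring.
Qed.

Lemma homogenize_exp n p e : (size p <= n.+1)%N ->
  homogenize (n * e) (p ^+ e) = homogenize n p ^+ e.
Proof.
move=> le_pn; elim: e => [|e IHe].
  by rewrite muln0 /homogenize big_ord1 coef1 rmorph1 !mulr1.
rewrite mulnS !exprS homogenizeM ?IHe //.
exact: size_exp_bound.
Qed.

End Homogenization.

Section Krawtchouk.
Variable n : nat.

(** The substitution [(u, v) -> (u + v, u - v)] applied to [u^(n - i) v^i], read at [u = 1],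
    [v = X]: a 45 degree rotation up to scale, written over the integers. *)
Definition krawtchouk_poly (i : nat) : {poly int} := (1 + 'X) ^+ (n - i) * (1 - 'X) ^+ i.
Definition krawtchouk (i j : nat) : int := (krawtchouk_poly i)`_j.

Lemma size_1DX (R : nzRingType) : (size (1 + 'X : {poly R})%R <= 2)%N.
Proof. by rewrite addrC -[1]opprK -polyCN size_XsubC. Qed.

Lemma size_1BX (R : nzRingType) : (size (1 - 'X : {poly R})%R <= 2)%N.
Proof. by rewrite -opprB size_polyN size_XsubC. Qed.

(** Applying [(u, v) -> (u + v, u - v)] twice is multiplication by 2. Here the second application is
    homogenization at [1 + X] and [1 - X], which turns the [i]-th polynomial into [2^n X^i]. *)
Lemma krawtchouk_inv i l : (i <= n)%N ->
  \sum_(j < n.+1) krawtchouk i j * krawtchouk j l = if i == l then 2 ^+ n else 0.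
Proof.
move=> le_in.
pose P := homogenize (@polyC int) (1 + 'X) (1 - 'X) n (krawtchouk_poly i).
have -> : \sum_(j < n.+1) krawtchouk i j * krawtchouk j l = P`_l.
  by rewrite coef_sum; apply: eq_bigr => j _; rewrite coefCM.
have -> : P = (2 ^+ n)%:P * 'X^i.
  have lin (p : {poly int}) : homogenize polyC (1 + 'X) (1 - 'X) 1 p =
     (p`_0)%:P * (1 + 'X) + (p`_1)%:P * (1 - 'X).
    by rewrite /homogenize !big_ord_recr big_ord0 /= add0r subn0 subnn !expr1 !expr0 mulr1 mul1r.
  have eq_n : n = (1 * (n - i) + 1 * i)%N by rewrite !mul1n subnK.
  rewrite /P {1}eq_n homogenizeM; last 2 first.
  - by apply: size_exp_bound; apply: size_1DX.
  - by apply: size_exp_bound; apply: size_1BX.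
  rewrite !homogenize_exp ?size_1DX ?size_1BX // !lin !coefE /= ?addr0 ?subr0 ?sub0r ?add0r.
  rewrite !polyCN !polyC1 !mul1r mulN1r opprB.
  have -> : 1 + 'X + (1 - 'X) = 2%:P :> {poly int} by rewrite -[2%:P]/((1+1)%:P) polyCD; ring.
  have -> : 1 + 'X + ('X - 1) = 2%:P * 'X :> {poly int} by rewrite -[2%:P]/((1+1)%:P) polyCD; ring.
  by rewrite exprMn mulrA -exprD subnK // polyC_exp.
by rewrite coefCM coefXn eq_sym; case: eqP; rewrite ?mulr1 ?mulr0.
Qed.

(** The generating function [((1 + X) + (1 - X) Y)^n] is symmetric in [X] and [Y], and both sides
    are its coefficients at exchanged positions. *)
Lemma krawtchouk_bin i j :
  krawtchouk i j *+ 'C(n, i) = krawtchouk j i *+ 'C(n, j).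
Proof.
pose P : {poly {poly int}} := ((1 + 'X)%:P + (1 - 'X)%:P * 'X) ^+ n.
have coefP l : P`_l = krawtchouk_poly l *+ 'C(n, l).
  rewrite /P exprDn coef_sum.
  have [lt_nl|le_ln] := ltnP n l.
    rewrite bin_small // mulr0n big1 // => i' _.
    rewrite coefMn exprMn -!polyC_exp !coefCM coefXn gtn_eqF ?mulr0 ?mul0rn //.
    exact: leq_trans (ltn_ord i') lt_nl.
  rewrite (bigD1 (Ordinal (le_ln : (l < n.+1)%N))) //= big1 ?addr0 => [|i' ne_i'l];
    rewrite coefMn exprMn -!polyC_exp !coefCM coefXn ?eqxx ?mulr1 //.
  by rewrite eq_sym (negPf (_ : (i' != l :> nat))) ?mulr0 ?mul0rn.
have symP : swapXY P = P.
  rewrite /P rmorphXn; congr (_ ^+ _).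
  rewrite !polyCD polyCN rmorphD rmorphM rmorphB rmorphD /= !swapXY_Y.
  by rewrite swapXY_X !polyC1 !rmorph1; ring.
have := coef_swapXY P i j.
by rewrite symP !coefP !coefMn.
Qed.

(** Exchanging [i] and [n - i] in the defining product amounts to replacing [X] by [-X]. *)
Lemma krawtchouk_opp i j : (i <= n)%N -> krawtchouk (n - i) j = (-1) ^+ j * krawtchouk i j.
Proof.
move=> le_in.
have -> : krawtchouk (n - i) j = (krawtchouk_poly i \Po (- 'X))`_j.
  rewrite /krawtchouk /krawtchouk_poly subKn // rmorphM !rmorphXn /=.
  by rewrite rmorphB rmorphD rmorph1 /= comp_polyX opprK mulrC.
rewrite coef_comp_poly -['X]mul1r -mulNr -polyC1 -polyCN.
under eq_bigr do rewrite exprMn -polyC_exp coefCM coefXn.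
have [lt_j|le_j] := ltnP j (size (krawtchouk_poly i)).
  rewrite (bigD1 (Ordinal lt_j)) //= eqxx mulr1 mulrC big1 ?addr0 // => l ne_lj.
  by rewrite eq_sym (negPf (_ : (l != j :> nat))) ?mulr0.
rewrite /krawtchouk nth_default // mulr0 big1 // => l _.
by rewrite gtn_eqF ?mulr0 // (leq_trans (ltn_ord l)).
Qed.

Lemma krawtchouk_subr i j : (i <= n)%N -> (j <= n)%N ->
  krawtchouk i (n - j) = (-1) ^+ i * krawtchouk i j.
Proof.
move=> le_in le_jn.
(* Over the integers the binomial can be cancelled, so the symmetry in the column index follows from
   the one in the row index. *)
have bin_neq0 : 'C(n, i)%:R != 0 :> int by rewrite pnatr_eq0 -lt0n bin_gt0.
apply: (mulIf bin_neq0); rewrite -mulrA !mulr_natr krawtchouk_bin bin_sub //.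
by rewrite krawtchouk_opp // krawtchouk_bin mulrnAr.
Qed.

(** The full sum for the row [n - i] vanishes and differs from the one for [i] by the signs
    [(-1)^j]. Hence the even and the odd [j] contribute equally, each half of the full sum. *)
Lemma sum_odd_krawtchouk i l : (i.*2 < n)%N -> (l.*2 < n)%N -> ~~ odd i -> ~~ odd l ->
  (\sum_(j < n.+1 | odd j) krawtchouk i j * krawtchouk j l) *+ 2
    = if i == l then 2 ^+ n else 0.
Proof.
move=> lt_in lt_ln ev_i ev_l; have le_in : (i <= n)%N by lia.
have S0 := krawtchouk_inv l le_in.
have : \sum_(j < n.+1) krawtchouk (n - i) j * krawtchouk j l = 0.
  by rewrite krawtchouk_inv ?leq_subr //; case: eqP => //; lia.
under eq_bigr do rewrite krawtchouk_opp // -signr_odd -mulrA.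
rewrite (bigID (fun j : 'I_n.+1 => odd j)) /= => S1.
rewrite -{}S0 [RHS](bigID (fun j : 'I_n.+1 => odd j)) /=.
rewrite mulr2n; congr (_ + _).
move/eqP: S1; rewrite addrC addr_eq0 => /eqP.
under eq_bigr => j nodd_j do rewrite (negPf nodd_j) mul1r.
move=> ->; rewrite -sumrN; apply: eq_bigr => j odd_j.
by rewrite odd_j mulN1r opprK.
Qed.

(** For [i] and [l] even the summand is unchanged under [j -> n - j], which preserves parity as [n]
    is even. Folding doubles every term except the middle one, which occurs only for odd [m]. *)
Lemma sum_lt_odd_krawtchouk m i l : n = m.*2 -> (i < m)%N -> (l < m)%N ->
  ~~ odd i -> ~~ odd l ->
  (\sum_(j < m | odd j) krawtchouk i j * krawtchouk j l) *+ 4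
    + (if odd m then krawtchouk i m * krawtchouk m l *+ 2 else 0)
    = if i == l then 2 ^+ n else 0.
Proof.
move=> def_n lt_im lt_lm ev_i ev_l.
have [lt_in lt_ln] : (i.*2 < n)%N /\ (l.*2 < n)%N by rewrite def_n !ltn_double.
rewrite -(sum_odd_krawtchouk lt_in lt_ln ev_i ev_l).
pose F j := krawtchouk i j * krawtchouk j l.
rewrite -(big_mkord (fun j => odd j) F) -(big_mkord (fun j => odd j) F).
have le_mn : (m <= n.+1)%N by rewrite def_n; lia.
rewrite (big_cat_nat (leq0n _) le_mn) /= [in RHS]mulrnDl.
rewrite (@big_ltn_cond _ _ _ m n.+1) /=; last by rewrite def_n; lia.
have -> : \sum_(m.+1 <= j < n.+1 | odd j) F j = \sum_(0 <= j < m | odd j) F j.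
  rewrite -{1}[m.+1]add0n big_addn (_ : n.+1 - m.+1 = m)%N; last by rewrite def_n; lia.
  rewrite big_nat_rev /= big_nat_cond [RHS]big_nat_cond.
  apply: eq_big => [j|j /andP[lt_jm _]].
    by case: (ltnP j m) => //= lt_jm; rewrite ?andbT; lia.
  have -> : (0 + m - j.+1 + m.+1 = n - j)%N by rewrite def_n; lia.
  rewrite /F krawtchouk_subr ?krawtchouk_opp; [|by rewrite def_n; lia..].
  by rewrite -(signr_odd _ i) -(signr_odd _ l) (negPf ev_i) (negPf ev_l) !mul1r.
by rewrite /F; case: (odd m); ring.
Qed.
End Krawtchouk.

(** * Exchange of even and odd indices over the base field *)

Section BaseChange.
Variables (k : fieldType) (m : nat).
Hypothesis two_neq0 : 2%:R != 0 :> k.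

Let n := m.*2.
Let kr i j : k := (krawtchouk n i j)%:~R.

Lemma sum_kr i l : (i < m)%N -> (l < m)%N -> ~~ odd i -> ~~ odd l ->
  (\sum_(j < m | odd j) kr i j * kr j l) *+ 4
    + (if odd m then kr i m * kr m l *+ 2 else 0)
    = if i == l then 2 ^+ m * 2 ^+ m else 0.
Proof.
move=> lt_im lt_lm ev_i ev_l.
have := congr1 (intmul (1 : k)) (sum_lt_odd_krawtchouk (erefl n) lt_im lt_lm ev_i ev_l).
rewrite rmorphD rmorphMn rmorph_sum /=.
under eq_bigr do rewrite rmorphM /=.
by case: (odd m); case: (i == l);
  rewrite ?rmorphMn ?rmorphM ?rmorphXn ?rmorph0 /= -?exprD ?addnn.
Qed.

(* Transition matrices between the basis vectors of even index and those of odd index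
   (index [m] included when [m] is odd). *)
Definition odd_of_even (j i : nat) : k := kr j i * (2 / 2 ^+ m).
Definition even_of_odd (i j : nat) : k :=
  kr i j * ((if j == m then 1 else 2) / 2 ^+ m).

(** When binomials vanish in [k] the form is degenerate, and preserving it does not make the
    transition matrix injective; this explicit left inverse does. *)
Lemma even_of_oddK i l : (i < m)%N -> (l < m)%N -> ~~ odd i -> ~~ odd l ->
  \sum_(j < m | odd j) even_of_odd i j * odd_of_even j l
    + (if odd m then even_of_odd i m * odd_of_even m l else 0) = (i == l)%:R.
Proof.
move=> lt_im lt_lm ev_i ev_l; have := sum_kr lt_im lt_lm ev_i ev_l.
have pow_neq0 : 2%:R ^+ m != 0 :> k by rewrite expf_neq0.
have -> : \sum_(j < m | odd j) even_of_odd i j * odd_of_even j l =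
   (\sum_(j < m | odd j) kr i j * kr j l) * (4 / (2 ^+ m * 2 ^+ m)).
  rewrite mulr_suml; apply: eq_bigr => j _.
  by rewrite /even_of_odd /odd_of_even ltn_eqF //; field.
rewrite /even_of_odd /odd_of_even eqxx.
set s := \sum_(j < m | _) _ => eq_s.
transitivity ((s *+ 4 + (if odd m then kr i m * kr m l *+ 2 else 0)) / (2 ^+ m * 2 ^+ m)).
  by case: (odd m); field.
by rewrite eq_s; case: eqP => _; rewrite ?mul0r // divff // mulf_neq0.
Qed.

(** By [krawtchouk_bin] the weight ['C(n, j)] can be traded for ['C(n, i)], which leaves the sum,
    and [sum_kr] applies. No binomial is ever inverted. *)
Lemma odd_of_even_isom i l : (i < m)%N -> (l < m)%N -> ~~ odd i -> ~~ odd l ->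
  \sum_(j < m | odd j) 2 * 'C(n, j)%:R * (odd_of_even j i * odd_of_even j l)
    + (if odd m then 'C(n, m)%:R * (odd_of_even m i * odd_of_even m l) else 0)
    = if i == l then 2 * 'C(n, i)%:R else 0.
Proof.
move=> lt_im lt_lm ev_i ev_l; have := sum_kr lt_im lt_lm ev_i ev_l.
have pow_neq0 : 2%:R ^+ m != 0 :> k by rewrite expf_neq0.
have kr_bin j : 'C(n, j)%:R * kr j i = 'C(n, i)%:R * kr i j.
  have := congr1 (intmul (1 : k)) (krawtchouk_bin n j i).
  by rewrite !rmorphMn !mulr_natl.
have -> : \sum_(j < m | odd j) 2 * 'C(n, j)%:R * (odd_of_even j i * odd_of_even j l)
   = 'C(n, i)%:R * (\sum_(j < m | odd j) kr i j * kr j l) * (8 / (2 ^+ m * 2 ^+ m)).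
  rewrite mulr_sumr mulr_suml; apply: eq_bigr => j _.
  transitivity ('C(n, j)%:R * kr j i * kr j l * (8 / (2 ^+ m * 2 ^+ m))).
    by rewrite /odd_of_even; field.
  by rewrite kr_bin !mulrA.
rewrite /odd_of_even; set s := \sum_(j < m | _) _ => eq_s.
transitivity (2 * 'C(n, i)%:R / (2 ^+ m * 2 ^+ m)
    * (s *+ 4 + (if odd m then kr i m * kr m l *+ 2 else 0))).
  case: (odd m); last by field.
  rewrite [X in _ + X](_ : _ = 'C(n, m)%:R * kr m i * kr m l * (4 / (2 ^+ m * 2 ^+ m))).
    by rewrite kr_bin; field.
  by field.
by rewrite eq_s; case: eqP => _; rewrite ?mulr0 // mulfVK ?mulf_neq0.
Qed.
End BaseChange.

(** * Expansion of powers of [A + B - 2 c] when [A B = c^2] *)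

Section Trinomial.
Variables (S : comNzRingType) (A B c : S).
Hypothesis AB : A * B = c ^+ 2.

(** [theta m i] stands for [s^(2m - i) t^i] with [A = s^2], [B = t^2], [c = s t], although [A] and
    [B] need not be squares in [S]. The relation [A B = c^2] is enough for multiplication by [A],
    [c], [B] to shift the index by 0, 1, 2. *)
Let theta m i := if (i <= m)%N then c ^+ i * A ^+ (m - i) else c ^+ (m.*2 - i) * B ^+ (i - m).
Let Theta m (p : {poly S}) := \sum_(i < m.*2.+1) p`_i * theta m i.

Let thetaA m i : (i < m.*2.+1)%N -> A * theta m i = theta m.+1 i.
Proof.
rewrite /theta ltnS => le_i; case: leqP => [le_im|lt_mi].
  by rewrite leqW // subSn // exprS; ring.
case: leqP => [le_i'|lt_i'].
  have [e def_m def_i] : exists2 e, m = e.+1 & i = e.+2 by exists m.-1; lia.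
  rewrite def_m def_i (_ : e.+1.*2 - e.+2 = e)%N; last by lia.
  by rewrite subnn subSnn expr1 expr0 mulr1 mulrCA AB -exprD addn2.
have -> : (m.+1.*2 - i = (m.*2 - i).+2)%N by lia.
have -> : (i - m = (i - m.+1).+1)%N by lia.
transitivity (A * B * (c ^+ (m.*2 - i) * B ^+ (i - m.+1))); first by rewrite exprS; ring.
by rewrite AB !exprS; ring.
Qed.

Let thetaC m i : (i < m.*2.+1)%N -> c * theta m i = theta m.+1 i.+1.
Proof.
rewrite /theta ltnS => le_i; rewrite ltnS; case: leqP => [le_im|lt_mi].
  by rewrite subSS exprS mulrA.
have -> : (m.+1.*2 - i.+1 = (m.*2 - i).+1)%N by lia.
by rewrite subSS exprS mulrA.
Qed.

Let thetaB m i : (i < m.*2.+1)%N -> B * theta m i = theta m.+1 i.+2.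
Proof.
rewrite /theta ltnS => le_i; rewrite ltnS; case: ltnP => [lt_im|le_mi].
  rewrite (ltnW lt_im); have -> : (m - i = (m - i.+1).+1)%N by lia.
  transitivity (A * B * (c ^+ i * A ^+ (m - i.+1))); first by rewrite exprS; ring.
  by rewrite AB subSS !exprS; ring.
have -> : (m.+1.*2 - i.+2 = m.*2 - i)%N by lia.
have -> : (i.+2 - m.+1 = (i - m).+1)%N by lia.
case: leqP => [le_im|lt_mi]; last by rewrite exprS; ring.
have -> : i = m by lia.
by rewrite subnn -addnn addKn !exprS; ring.
Qed.

Let ThetaX m (p : {poly S}) : (size p <= m.*2.+1)%N ->
  [/\ Theta m.+1 p = A * Theta m p, Theta m.+1 (p * 'X) = c * Theta m p
    & Theta m.+1 (p * 'X * 'X) = B * Theta m p].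
Proof.
move=> le_p.
have p0 i : (m.*2 < i)%N -> p`_i = 0 by move=> lt_i; rewrite nth_default // (leq_trans le_p).
rewrite /Theta doubleS; split.
- rewrite big_ord_recr big_ord_recr /= !p0 // !mul0r !addr0 mulr_sumr.
  by apply: eq_bigr => i _; rewrite -(thetaA (ltn_ord i)) mulrCA.
- rewrite big_ord_recr big_ord_recl /= !coefMX /= p0 // !mul0r addr0 add0r mulr_sumr.
  by apply: eq_bigr => i _; rewrite coefMX /= -(thetaC (ltn_ord i)) mulrCA.
rewrite big_ord_recl big_ord_recl /= !coefMX /= !mul0r !add0r mulr_sumr.
by apply: eq_bigr => i _; rewrite !coefMX /= -(thetaB (ltn_ord i)) mulrCA.
Qed.

Let ThetaD m p q : Theta m (p + q) = Theta m p + Theta m q.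
Proof. by rewrite /Theta -big_split; apply: eq_bigr => i _; rewrite /= coefD mulrDl. Qed.

Let ThetaN m p : Theta m (- p) = - Theta m p.
Proof. by rewrite /Theta -sumrN; apply: eq_bigr => i _; rewrite /= coefN mulNr. Qed.

Let Theta_exp m : Theta m ((1 - 'X) ^+ m.*2) = (A + B - 2 * c) ^+ m.
Proof.
elim: m => [|m IHm]; first by rewrite /Theta big_ord1 expr0 coef1 /theta !mul1r.
rewrite doubleS !exprS -{}IHm; set p := (1 - 'X) ^+ _.
have [eqA eqC eqB] : [/\ Theta m.+1 p = A * Theta m p, Theta m.+1 (p * 'X) = c * Theta m p
    & Theta m.+1 (p * 'X * 'X) = B * Theta m p].
  have size_1BX : size (1 - 'X : {poly S}) = 2 by rewrite -opprB size_polyN size_XsubC.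
  by apply: ThetaX; have := size_poly_exp_leq (1 - 'X : {poly S}) m.*2; rewrite size_1BX mul1n.
(* Under [Theta], multiplication by [(1 - X)^2 = 1 - 2 X + X^2] becomes multiplication by
   [A - 2 c + B]. *)
have -> : (1 - 'X) * ((1 - 'X) * p) = p + p * 'X * 'X - (p * 'X + p * 'X) by ring.
by rewrite ThetaD ThetaN !ThetaD eqA eqB eqC; ring.
Qed.

(* With [A = s^2], [B = t^2], [c = s t] this is the binomial expansion of [(s - t)^(2m)]. *)
Lemma trinomial_exp m :
  (A + B - 2 * c) ^+ m
    = \sum_(i < m) (-1) ^+ i * 'C(m.*2, i)%:R * c ^+ i * (A ^+ (m - i) + B ^+ (m - i))
      + (-1) ^+ m * 'C(m.*2, m)%:R * c ^+ m.
Proof.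
have coef_exp i : ((1 - 'X : {poly S}) ^+ m.*2)`_i = (-1) ^+ i * 'C(m.*2, i)%:R.
  rewrite exprBn coef_sum; have [lt_i|le_i] := ltnP m.*2 i.
    rewrite bin_small // mulr0 big1 // => j _; rewrite coefMn expr1n mulr1.
    rewrite -[-1]opprK -polyC1 -polyCN opprK -polyC_exp coefCM coefXn.
    by rewrite gtn_eqF ?mulr0 ?mul0rn // (leq_trans (ltn_ord j)).
  have eqF j : ((-1) ^+ j * 1 ^+ (m.*2 - j) * 'X ^+ j *+ 'C(m.*2, j) : {poly S})`_i
      = (if i == j then (-1) ^+ j * 'C(m.*2, j)%:R else 0).
    rewrite coefMn expr1n mulr1 -polyC1 -polyCN -polyC_exp coefCM coefXn.
    by case: eqP => _; rewrite ?mulr1 ?mulr0 ?mul0rn // mulr_natr.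
  under eq_bigr do rewrite eqF.
  rewrite (bigD1 (Ordinal (le_i : (i < m.*2.+1)%N))) //= eqxx big1 ?addr0 // => j.
  by rewrite eq_sym => /negPf; rewrite -val_eqE /= => ->.
rewrite -Theta_exp /Theta; under eq_bigr do rewrite coef_exp.
pose F i := (-1) ^+ i * 'C(m.*2, i)%:R * theta m i.
rewrite (sum_fold m F); congr (_ + _); last first.
  by rewrite /F /theta leqnn subnn expr0 mulr1.
apply: eq_bigr => i _; have lt_im := ltn_ord i.
rewrite /F /theta bin_sub; last by lia.
rewrite (ltnW lt_im) leqNgt (_ : (m < m.*2 - i)%N) /=; last by lia.
rewrite subKn; last by lia.
have -> : (m.*2 - i - m = m - i)%N by lia.
rewrite -[(-1) ^+ (_ - _)]signr_odd oddB; last by lia.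
by rewrite odd_double /= signr_odd; ring.
Qed.
End Trinomial.

(** * Invariant tensors on the conic *)

(** The basis function [hbasis] evaluated at a point: classes modulo the conic equation are handled
    through their values at points over arbitrary commutative rings. *)
Definition hval (S : comNzRingType) (m i : nat) (x y z : S) : S :=
  if (i <= m)%N then y ^+ (m - i) * z ^+ i
  else x * y ^+ (m.-1 - (i - m.+1)) * z ^+ (i - m.+1).

Lemma rmorph_hval (S T : comNzRingType) (f : {rmorphism S -> T}) m i (x y z : S) :
  f (hval m i x y z) = hval m i (f x) (f y) (f z).
Proof. by rewrite /hval; case: ifP => _; rewrite !rmorphM !rmorphXn. Qed.

Lemma sum_mulmx_row (S : comNzRingType) (p q : nat) (M : 'M[S]_(p, q)) (v : 'rV_p) (w : 'rV_q) :
  \sum_i \sum_j M i j * (v 0 i * w 0 j) = (v *m M *m w^T) 0 0.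
Proof.
rewrite mxE exchange_big; apply: eq_bigr => j _ /=.
by rewrite !mxE mulr_suml; apply: eq_bigr => i _; ring.
Qed.

Section Conic.
Variables (k : fieldType) (a b : k).

Definition on_conic (S : comNzRingType) (f : k -> S) (x y z : S) : Prop :=
  qnorm (f a) (f b) (0, x, y, z) = 0.

Definition polar (S : comNzRingType) (f : k -> S) (x y z x' y' z' : S) : S :=
  2 * (f a * f b * z * z' - f a * x * x' - f b * y * y').

Definition qact (S : comNzRingType) (A B : S) (g : quat S) (x y z : S) : quat S :=
  qmul A B (qmul A B (qconj g) (0, x, y, z)) g.

Section Action.
Variables (S : comNzRingType) (f : k -> S) (g : quat S).
Hypothesis g1 : qnorm (f a) (f b) g = 1.
Let act1 x y z := (qact (f a) (f b) g x y z).1.1.2.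
Let act2 x y z := (qact (f a) (f b) g x y z).1.2.
Let act3 x y z := (qact (f a) (f b) g x y z).2.

Lemma on_conic_act x y z : on_conic f x y z ->
  on_conic f (act1 x y z) (act2 x y z) (act3 x y z).
Proof.
rewrite /on_conic => N0.
transitivity (qnorm (f a) (f b) g ^+ 2 * qnorm (f a) (f b) (0, x, y, z)).
  by rewrite /act1 /act2 /act3; case: g => [[[g0 g1'] g2] g3] /=; ring.
by rewrite N0 mulr0.
Qed.

Lemma polar_act x y z x' y' z' :
  polar f (act1 x y z) (act2 x y z) (act3 x y z) (act1 x' y' z') (act2 x' y' z') (act3 x' y' z')
  = polar f x y z x' y' z'.
Proof.
transitivity (qnorm (f a) (f b) g ^+ 2 * polar f x y z x' y' z').
  by rewrite /polar /act1 /act2 /act3; case: g => [[[g0 g1'] g2] g3] /=; ring.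
by rewrite g1 expr1n mul1r.
Qed.
End Action.

Definition qmap (R S : Type) (f : R -> S) (g : quat R) : quat S :=
  let: (g0, g1, g2, g3) := g in (f g0, f g1, f g2, f g3).

Lemma qmap_mul (R S : comNzRingType) (f : {rmorphism R -> S}) (A B : R) (g h : quat R) :
  qmap f (qmul A B g h) = qmul (f A) (f B) (qmap f g) (qmap f h).
Proof.
case: g h => [[[g0 g1] g2] g3] [[[h0 h1] h2] h3].
by rewrite /= !(rmorphD, rmorphN, rmorphM).
Qed.

(** The action matrix is defined by a congruence modulo [Npoly]. At a point of the conic the
    multiple of [Npoly] vanishes, so the congruence becomes an equality of values. *)
Lemma action_matrix_eval (R : comAlgType k) (S : comNzRingType) (f : {rmorphism R -> S})
    m (g : quat R) (A : 'M[R]_(m.*2.+1)) (x y z : S) (j : 'I_(m.*2.+1)) :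
  let fk := f \o in_alg R in let q := qact (fk a) (fk b) (qmap f g) x y z in
  action_matrix a b g A -> on_conic fk x y z ->
  hval m j q.1.1.2 q.1.2 q.2 = \sum_i f (A i j) * hval m i x y z.
Proof.
case: g => [[[g0 g1] g2] g3] fk q /(_ j) [c eq_c] N0.
pose E : {rmorphism {mpoly R[3]} -> S} := mmap f (tnth [tuple x; y; z]).
have EC r : E r%:MP = f r by rewrite /E /= mmapC.
have EX i : E 'X_i = tnth [tuple x; y; z] i by rewrite /E /= mmapX mmap1U.
have Eh (i : 'I_(m.*2.+1)) : E (hbasis R i) = hval m i x y z.
  by rewrite /hbasis /hval; case: ifP => _; rewrite !rmorphM !rmorphXn !EX !(tnth_nth 0).
have ENp : E (Npoly a b R) = 0.
  rewrite -[RHS]N0 /Npoly /= !(rmorphD, rmorphN, rmorphXn, rmorphM, rmorph0) /=.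
  by rewrite !EX !EC !(tnth_nth 0).
have Eadj i : E (tnth (adjt a b (g0, g1, g2, g3)) i) = tnth [tuple q.1.1.2; q.1.2; q.2] i.
  rewrite /adjt; set Q := qmul _ _ (qmul _ _ _ _) _.
  have EQ : qmap E Q = q.
    rewrite /Q !qmap_mul !EC /q /qact; congr (qmul _ _ (qmul _ _ _ _) _).
    - by rewrite /= !rmorphN !EC.
    - by rewrite /= rmorph0 !EX !(tnth_nth 0).
    - by rewrite /= !EC.
  case: Q EQ => [[[r0 r1] r2] r3] <-.
  by case: i => -[|[|[|//]]] lt_i; rewrite !(tnth_nth 0).
have : E (hbasis R j \mPo adjt a b (g0, g1, g2, g3)) = hval m j q.1.1.2 q.1.2 q.2.
  rewrite /hbasis /hval; case: ifP => _; rewrite !rmorphM !rmorphXn /= !comp_mpolyXU;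
    by rewrite -!tnth_nth !Eadj !(tnth_nth 0).
move: eq_c; move: (_ \mPo _) => h eq_c Eh'.
move/eqP: (congr1 E eq_c); rewrite rmorphM ENp mulr0 rmorphB rmorph_sum subr_eq0 => /eqP eq_Eh.
apply: etrans (esym Eh') (etrans eq_Eh _).
by apply: eq_bigr => i _; rewrite /= mmapZ -Eh.
Qed.


(* The witness is the generic point [(xi, 1, X)] of the affine conic [y = 1]. *)
Lemma hval_free (a_neq0 : a != 0) (R : comNzRingType) (f : {rmorphism k -> R}) (m : nat) :
  (0 < m)%N ->
  exists (S : comNzRingType) (u : {rmorphism R -> S}) (x y z : S),
    on_conic (u \o f) x y z /\
    forall c : 'I_(m.*2.+1) -> R, \sum_i u (c i) * hval m i x y z = 0 -> forall i, c i = 0.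
Proof.
(* At [y = 1], [z = X] the conic equation reads [a x^2 = - b (1 - a X^2)]; [d] is the value it
   forces on [x^2]. *)
move=> m_gt0; pose d : {poly R} := (f (- (b / a)))%:P * (1 - (f a)%:P * 'X ^+ 2).
have Nd : - ((f a)%:P * d) - (f b)%:P + (f a)%:P * (f b)%:P * 'X ^+ 2 = 0.
  have fab : f a * f (- (b / a)) = - f b by rewrite -rmorphM -rmorphN; congr (f _); field.
  by rewrite /d mulrA -polyCM fab polyCN; ring.
move: d Nd => d Nd; pose u : {rmorphism R -> sqext d} := @sqext_in _ d \o polyC.
exists (sqext d), u, (sqext_root d), 1, (sqext_in d 'X); split.
  rewrite /on_conic -[RHS](rmorph0 (@sqext_in _ d)) -Nd.
  rewrite !(rmorphD, rmorphN, rmorphM, rmorphXn) /= sqext_rootK.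
  by rewrite expr0n expr1n mulr1 sub0r.
move=> c sum0.
pose P : {poly R} := \poly_(i < m.+1) c (inord i).
pose Q : {poly R} := \poly_(i < m) c (inord (i + m.+1)).
(* The basis functions free of [x] give the component [P], those linear in [x] the component [Q]
   along the adjoined root. *)
have [P0 Q0] : P = 0 /\ Q = 0.
  apply: (@sqext_eq0 _ d); rewrite -[RHS]sum0 /P /Q !poly_def.
  pose F i := u (c (inord i)) * hval m i (sqext_root d) 1 (sqext_in d 'X).
  transitivity (\sum_(i < m.*2.+1) F i); last by apply: eq_bigr => i _; rewrite /F inord_val.
  have le_m : (m.+1 <= m.*2.+1)%N by lia.
  rewrite -(big_mkord xpredT F) (big_cat_nat (leq0n _) le_m) /=.
  rewrite [X in _ = _ + X](big_addn 0 _ m.+1) (_ : m.*2.+1 - m.+1 = m)%N; last by lia.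
  rewrite !big_mkord !rmorph_sum mulr_sumr.
  congr (_ + _); apply: eq_bigr => i _; rewrite /F /hval /=.
    by rewrite -ltnS ltn_ord expr1n mul1r -mul_polyC rmorphM rmorphXn.
  rewrite leqNgt addnS ltnS leq_addl /= expr1n mulr1 subSS addnK.
  by rewrite -mul_polyC rmorphM rmorphXn mulrCA.
move=> i; have [le_im|lt_mi] := leqP i m.
  by have := congr1 (fun p : {poly R} => p`_i) P0;
     rewrite coef_poly coef0 ltnS le_im inord_val.
have := congr1 (fun p : {poly R} => p`_(i - m.+1)) Q0; rewrite coef_poly coef0 subnK //.
by rewrite ifT ?inord_val //; have := ltn_ord i; lia.
Qed.

(** The group preserves the polar form, hence its power as a function of two points. A tensor is
    determined by its value at a pair of independent generic points, so equality of functions gives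
    equality of tensors. *)
Lemma tensor_invariant (a_neq0 : a != 0) m (G : 'M[k]_(m.*2.+1)) : (0 < m)%N ->
  (forall (S : comNzRingType) (f : {rmorphism k -> S}) (x y z x' y' z' : S),
     on_conic f x y z -> on_conic f x' y' z' ->
     \sum_i \sum_j f (G i j) * (hval m i x y z * hval m j x' y' z')
       = polar f x y z x' y' z' ^+ m) ->
  SLQ_invariant a b G.
Proof.
move=> m_gt0 tensorG R g A g1 actA.
have [S1 [u1 [x [y [z [Np free1]]]]]] := hval_free a_neq0 (in_alg R) m_gt0.
(* The second generic point is built over the ring of the first, which makes the two independent. *)
have [S [u2 [x' [y' [z' [Nq free2]]]]]] := hval_free a_neq0 (u1 \o in_alg R) m_gt0.
pose u : {rmorphism R -> S} := u2 \o u1.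
pose f : {rmorphism k -> S} := u \o in_alg R.
have Np' : on_conic f (u2 x) (u2 y) (u2 z).
  have := congr1 u2 Np; rewrite rmorph0 => Np2; rewrite /on_conic -[RHS]Np2 /=.
  by rewrite !(rmorphD, rmorphN, rmorphXn, rmorphM, rmorph0).
have h1 : qnorm (f a) (f b) (qmap u g) = 1.
  rewrite -(rmorph1 u) -g1; case: (g) => [[[g0 g1'] g2] g3] /=.
  by rewrite !(rmorphD, rmorphN, rmorphXn, rmorphM).
set G' := map_mx _ G.
suff : A *m G' *m A^T - G' = 0 by move/eqP; rewrite subr_eq0 => /eqP.
set B := _ - G'.
suff sumB : \sum_i \sum_j u (B i j) * (hval m i (u2 x) (u2 y) (u2 z) * hval m j x' y' z') = 0.
  apply/matrixP => i j; rewrite [RHS]mxE; refine (free1 (fun i => B i j) _ i).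
  refine (free2 (fun j => \sum_i u1 (B i j) * hval m i x y z) _ j).
  rewrite -[RHS]sumB exchange_big; apply: eq_bigr => l _.
  rewrite /= rmorph_sum mulr_suml; apply: eq_bigr => i' _.
  by rewrite rmorphM rmorph_hval mulrA.
have evalA (p1 p2 p3 : S) j := @action_matrix_eval R S u m g A p1 p2 p3 j actA.
have := polar_act h1 (u2 x) (u2 y) (u2 z) x' y' z'.
move/(congr1 (fun t => t ^+ m)).
rewrite -!tensorG //; last 2 first.
- exact: on_conic_act.
- exact: on_conic_act.
move/eqP; rewrite -subr_eq0 => /eqP eqT; rewrite -[RHS]eqT.
pose FG := map_mx f G; pose UA := map_mx u A.
pose hP : 'rV[S]_(m.*2.+1) := \row_i hval m i (u2 x) (u2 y) (u2 z).
pose hQ : 'rV[S]_(m.*2.+1) := \row_i hval m i x' y' z'.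
have -> : \sum_i \sum_j f (G i j) * (hval m i (u2 x) (u2 y) (u2 z) * hval m j x' y' z')
    = (hP *m FG *m hQ^T) 0 0.
  by rewrite -sum_mulmx_row; apply: eq_bigr => i _; apply: eq_bigr => j _; rewrite !mxE.
rewrite -(sum_mulmx_row FG hP hQ).
have -> : \sum_i \sum_j u (B i j) * (hval m i (u2 x) (u2 y) (u2 z) * hval m j x' y' z')
    = (hP *m map_mx u B *m hQ^T) 0 0.
  by rewrite -sum_mulmx_row; apply: eq_bigr => i _; apply: eq_bigr => j _; rewrite !mxE.
have -> : map_mx u B = UA *m FG *m UA^T - FG.
  rewrite /B map_mxB !map_mxM map_trmx; congr (_ *m _ *m _ - _);
  by rewrite /G' -map_mx_comp.
rewrite mulmxBr mulmxBl !mulmxA [LHS]mxE [X in _ + X]mxE; congr (_ - _); last first.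
  by rewrite sum_mulmx_row.
rewrite -(mulmxA _ UA^T) -trmx_mul -sum_mulmx_row.
apply: eq_bigr => i _; apply: eq_bigr => j _; rewrite mxE; congr (_ * (_ * _)).
  by rewrite [RHS]evalA // mxE; apply: eq_bigr => l _; rewrite !mxE mulrC.
by rewrite [RHS]evalA // mxE; apply: eq_bigr => l _; rewrite !mxE mulrC.
Qed.
End Conic.

(** * The weight basis *)

Lemma rmorph_homog (R S T : comNzRingType) (f : {rmorphism R -> S}) (u : {rmorphism S -> T})
    s t n p : u (homogenize f s t n p) = homogenize (u \o f) (u s) (u t) n p.
Proof. by rewrite /homogenize rmorph_sum; apply: eq_bigr => j _; rewrite !rmorphM !rmorphXn. Qed.

Section Basis.
Variables (k : fieldType) (a b : k).

(* [(y + sqrt a z)^d = P + sqrt a Q], with [P] and [Q] dehomogenized at [y = 1]. *)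
Fixpoint wpoly (d : nat) : {poly k} * {poly k} :=
  if d is e.+1 then ((wpoly e).1 + a *: ('X * (wpoly e).2), 'X * (wpoly e).1 + (wpoly e).2)
  else (1, 0).

Lemma size_wpoly d : (size (wpoly d).1 <= d.+1)%N /\ (size (wpoly d).2 <= d.+1)%N.
Proof.
elim: d => [|d [IH1 IH2]]; first by rewrite size_poly1 size_poly0.
have szX (p : {poly k}) : (size p <= d.+1)%N -> (size ('X * p)%R <= d.+2)%N.
  move=> le_p; apply: leq_trans (size_polyMleq _ _) _.
  by rewrite size_polyX.
split; apply: leq_trans (size_polyD _ _) _; rewrite geq_max.
  by rewrite leqW //= (leq_trans (size_scale_leq _ _)) ?szX.
by rewrite szX //= leqW.
Qed.

Section Eval.
Variables (S : comNzRingType) (f : {rmorphism k -> S}).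

Lemma homogenize_wpoly (s y z : S) d : s ^+ 2 = f a ->
  (y + s * z) ^+ d = homogenize f y z d (wpoly d).1 + s * homogenize f y z d (wpoly d).2 /\
  (y - s * z) ^+ d = homogenize f y z d (wpoly d).1 - s * homogenize f y z d (wpoly d).2.
Proof.
move=> def_s; elim: d => [|d [IH1 IH2]].
  by rewrite /homogenize !big_ord1 /= coef1 coef0 rmorph1 rmorph0 !mul0r mulr0 !mulr1 subr0 addr0.
have [sz1 sz2] := size_wpoly d.
have homog1 (p : {poly k}) : (size p <= d.+1)%N ->
    homogenize f y z d.+1 p = y * homogenize f y z d p.
  move=> le_p; rewrite -{1}[p]mul1r -add1n homogenizeM ?size_poly1 //; congr (_ * _).
  by rewrite /homogenize big_ord_recr big_ord1 /= !coef1 rmorph1 rmorph0 mul0r addr0 mul1r mulr1.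
have homogX (p : {poly k}) : (size p <= d.+1)%N ->
    homogenize f y z d.+1 ('X * p) = z * homogenize f y z d p.
  move=> le_p; rewrite -add1n homogenizeM ?size_polyX //; congr (_ * _).
  by rewrite /homogenize big_ord_recr big_ord1 /= !coefX rmorph1 rmorph0 mul0r add0r mul1r mul1r.
rewrite !exprS IH1 IH2 /= !homogenizeD homogenizeZ !homogX // !homog1 //.
by rewrite -def_s; split; ring.
Qed.
End Eval.

Variable m : nat.

Definition ev (S : comNzRingType) (f : k -> S) (x y z : S) (v : 'rV[k]_(m.*2.+1)) : S :=
  \sum_i f (v 0 i) * hval m i x y z.

Section EvLinear.
Variables (S : comNzRingType) (f : {rmorphism k -> S}) (x y z : S).

Lemma evD v w : ev f x y z (v + w) = ev f x y z v + ev f x y z w.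
Proof. by rewrite /ev -big_split /=; apply: eq_bigr => i _; rewrite mxE rmorphD mulrDl. Qed.

Lemma evZ c v : ev f x y z (c *: v) = f c * ev f x y z v.
Proof. by rewrite /ev mulr_sumr; apply: eq_bigr => i _; rewrite mxE rmorphM -mulrA. Qed.

Lemma ev0 : ev f x y z 0 = 0.
Proof. by rewrite /ev big1 // => i _; rewrite mxE rmorph0 mul0r. Qed.

Lemma ev_sum (I : Type) (r : seq I) (P : pred I) (F : I -> 'rV_(m.*2.+1)) :
  ev f x y z (\sum_(i <- r | P i) F i) = \sum_(i <- r | P i) ev f x y z (F i).
Proof. exact: (big_morph (ev f x y z) evD ev0). Qed.
End EvLinear.

Lemma ev_split (S : comNzRingType) (f : {rmorphism k -> S}) (x y z : S) (P Q : {poly k}) :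
  (0 < m)%N ->
  ev f x y z (\row_l if (l <= m)%N then P`_l else Q`_(l - m.+1))
    = homogenize f y z m P + x * homogenize f y z m.-1 Q.
Proof.
move=> m_gt0; have le_m : (m.+1 <= m.*2.+1)%N by lia.
pose F l := f (if (l <= m)%N then P`_l else Q`_(l - m.+1)) * hval m l x y z.
transitivity (\sum_(l < m.*2.+1) F l); first by apply: eq_bigr => l _; rewrite mxE.
rewrite -(big_mkord xpredT F) (big_cat_nat (leq0n _) le_m) /=.
rewrite [X in _ + X](big_addn 0 _ m.+1) (_ : m.*2.+1 - m.+1 = m)%N; last by lia.
rewrite !big_mkord /homogenize prednK // mulr_sumr.
congr (_ + _); apply: eq_bigr => l _; rewrite /F /hval; first by rewrite -ltnS ltn_ord.
by rewrite leqNgt addnS ltnS leq_addl /= subSS addnK; ring.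
Qed.

(* The class of [x^i T(y, z)], with [T] of degree [m - i], after the substitution
   [x^2 = - (b / a) (y^2 - a z^2)]. *)
Definition xmonom (i : nat) (T : {poly k}) : 'rV[k]_(m.*2.+1) :=
  let P := (- (b / a) *: (1 - a *: 'X^2)) ^+ i./2 * T in
  \row_l if (l <= m)%N then (if odd i then 0 else P`_l)
         else (if odd i then P`_(l - m.+1) else 0).

Lemma ev_xmonom (S : comNzRingType) (f : {rmorphism k -> S}) (x y z : S) i (T : {poly k}) :
  a != 0 -> (0 < m)%N ->
  on_conic a b f x y z -> (i <= m)%N -> (size T <= (m - i).+1)%N ->
  ev f x y z (xmonom i T) = x ^+ i * homogenize f y z (m - i) T.
Proof.
move=> a_neq0 m_gt0 Nx le_im sz_T; rewrite /xmonom.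
pose q := - (b / a) *: (1 - a *: 'X^2); set P := _ * T.
have sz_q : (size q <= 3)%N.
  rewrite (leq_trans (size_scale_leq _ _)) // (leq_trans (size_polyD _ _)) //.
  by rewrite size_poly1 size_polyN geq_max /= (leq_trans (size_scale_leq _ _)) ?size_polyXn.
(* On the conic [q] represents [x^2], so all but at most one factor [x] can be traded for forms in
   [y] and [z]. *)
have homog_q : homogenize f y z 2 q = x ^+ 2.
  have homog_1 : homogenize f y z 2 1 = y ^+ 2.
    by rewrite -(expr0 'X) homogenizeXn // mulr1.
  rewrite homogenizeZ homogenizeD -scaleN1r !homogenizeZ homogenizeXn // homog_1 subnn expr0 mul1r.
  have fa : f a * f a^-1 = 1 by rewrite -rmorphM divff ?rmorph1.
  move: Nx; rewrite /on_conic /= rmorphN rmorphN1 rmorphM => Nx.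
  transitivity (x ^+ 2 * (f a * f a^-1) + f a^-1 * 0); last by rewrite fa; ring.
  by rewrite -Nx; ring: fa.
have homog_P : homogenize f y z (2 * i./2 + (m - i)) P
    = x ^+ (i./2).*2 * homogenize f y z (m - i) T.
  rewrite /P homogenizeM //; last exact: size_exp_bound.
  by rewrite homogenize_exp // homog_q -exprM mul2n.
have i_eq := odd_double_half i.
case: (odd i) i_eq => i_eq.
  rewrite (_ : \row__ _ = \row_l if (l <= m)%N then (0 : {poly k})`_l else P`_(l - m.+1)).
    rewrite ev_split // homogenize0 add0r (_ : m.-1 = 2 * i./2 + (m - i))%N; last by lia.
    by rewrite homog_P mulrA -exprS; congr (x ^+ _ * _).
  by apply/rowP => l; rewrite !mxE coef0.
rewrite (_ : \row__ _ = \row_l if (l <= m)%N then P`_l else (0 : {poly k})`_(l - m.+1)).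
  rewrite ev_split // homogenize0 mulr0 addr0 -{1}(subnKC le_im) -{1}i_eq add0n -mul2n.
  by rewrite homog_P -{3}i_eq.
by apply/rowP => l; rewrite !mxE coef0.
Qed.

Section Tensor.
Hypotheses (two_neq0 : 2%:R != 0 :> k) (a_neq0 : a != 0) (b_neq0 : b != 0) (m_gt0 : (0 < m)%N).

Definition basis_re i := xmonom i (wpoly (m - i)).1.
Definition basis_im i := xmonom i (wpoly (m - i)).2.
Definition basis_mid := xmonom m 1.

Lemma ev_mid (S : comNzRingType) (f : {rmorphism k -> S}) (x y z : S) :
  on_conic a b f x y z -> ev f x y z basis_mid = x ^+ m.
Proof.
move=> Nx; rewrite ev_xmonom ?size_poly1 // subnn.
by rewrite /homogenize big_ord1 coef1 rmorph1 !mulr1.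
Qed.

Section SquareRoot.
Variables (S : comNzRingType) (f : {rmorphism k -> S}) (s : S).
Hypothesis def_s : s ^+ 2 = f a.

Local Notation re y z d := (homogenize f y z d (wpoly d).1).
Local Notation im y z d := (homogenize f y z d (wpoly d).2).

Lemma tensor_basis_sqrt (x y z x' y' z' : S) : on_conic a b f x y z -> on_conic a b f x' y' z' ->
  \sum_(i < m) f (2 * (-1) ^+ m * a ^+ i * b ^+ (m - i) * 'C(m.*2, i)%:R) *
      ((x ^+ i * re y z (m - i)) * (x' ^+ i * re y' z' (m - i))
       - f a * ((x ^+ i * im y z (m - i)) * (x' ^+ i * im y' z' (m - i))))
    + f ((-1) ^+ m * a ^+ m * 'C(m.*2, m)%:R) * (x ^+ m * x' ^+ m)
  = polar a b f x y z x' y' z' ^+ m.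
Proof.
rewrite /on_conic /= => Np Nq.
(* With [w = y + s z] and bars for the change of sign of [s], [A] is [- b w] times the bar of [w'],
   and [B] is its conjugate. Multiplying the conic equations of the two points gives [A B = c^2]. *)
pose A := - f b * (y + s * z) * (y' - s * z').
pose B := - f b * (y - s * z) * (y' + s * z').
pose c := f a * x * x'.
have eq_p : f a * x ^+ 2 = - f b * ((y + s * z) * (y - s * z)).
  apply/eqP; rewrite -subr_eq0 -oppr_eq0 -[X in _ == X]Np; apply/eqP.
  by ring: def_s.
have eq_q : f a * x' ^+ 2 = - f b * ((y' + s * z') * (y' - s * z')).
  apply/eqP; rewrite -subr_eq0 -oppr_eq0 -[X in _ == X]Nq; apply/eqP.
  by ring: def_s.
have AB : A * B = c ^+ 2.
  transitivity ((f a * x ^+ 2) * (f a * x' ^+ 2)); last by rewrite /c; ring.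
  by rewrite eq_p eq_q /A /B; ring.
have -> : polar a b f x y z x' y' z' = A + B - 2 * c.
  by rewrite /polar /A /B /c -def_s; ring.
rewrite trinomial_exp //; congr (_ + _); last first.
  by rewrite /c !exprMn !rmorphM !rmorphXn rmorph_nat rmorphN1; ring.
apply: eq_bigr => i _; have le_im : (i <= m)%N by rewrite ltnW.
(* In the sum of conjugates the terms odd in [s] cancel, leaving twice the product of real parts
   minus [a] times the product of imaginary parts. *)
rewrite /A /B !exprMn.
have [-> ->] := homogenize_wpoly y z (m - i) def_s.
have [-> ->] := homogenize_wpoly y' z' (m - i) def_s.
rewrite !rmorphM !rmorphXn !rmorph_nat rmorphN1.
rewrite -{1}(subnK le_im) exprD [(- f b) ^+ _]exprNn -def_s; ring.
Qed.

End SquareRoot.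

(** The identity does not mention the square root of [a], so it may be checked after formally
    adjoining one, because [S] embeds in [sqext (f a)]. *)
Lemma tensor_basis (S : comNzRingType) (f : {rmorphism k -> S}) (x y z x' y' z' : S) :
  on_conic a b f x y z -> on_conic a b f x' y' z' ->
  \sum_(i < m) f (2 * (-1) ^+ m * a ^+ i * b ^+ (m - i) * 'C(m.*2, i)%:R) *
      (ev f x y z (basis_re i) * ev f x' y' z' (basis_re i)
       - f a * (ev f x y z (basis_im i) * ev f x' y' z' (basis_im i)))
    + f ((-1) ^+ m * a ^+ m * 'C(m.*2, m)%:R) * (ev f x y z basis_mid * ev f x' y' z' basis_mid)
  = polar a b f x y z x' y' z' ^+ m.
Proof.
move=> Np Nq; rewrite !ev_mid //.
pose u : {rmorphism S -> sqext (f a)} := @sqext_in _ (f a).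
have conic_u p1 p2 p3 : on_conic a b f p1 p2 p3 ->
    on_conic a b (u \o f) (u p1) (u p2) (u p3).
  move=> N0; have := congr1 u N0; rewrite rmorph0 => N1; rewrite /on_conic -[RHS]N1 /=.
  by rewrite !(rmorphD, rmorphN, rmorphXn, rmorphM, rmorph0).
apply: (@sqext_inj _ (f a)); rewrite -/(u _) -/(u _).
have := @tensor_basis_sqrt _ (u \o f) (sqext_root (f a)) (sqext_rootK _) _ _ _ _ _ _
  (conic_u _ _ _ Np) (conic_u _ _ _ Nq).
have -> : polar a b (u \o f) (u x) (u y) (u z) (u x') (u y') (u z')
    = u (polar a b f x y z x' y' z').
  by rewrite /polar !(rmorphM, rmorphB, rmorph_nat).
rewrite rmorphXn => <-; rewrite rmorphD rmorph_sum; congr (_ + _); last first.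
  by rewrite !rmorphM !rmorphXn.
apply: eq_bigr => i _; have le_im : (i <= m)%N by rewrite ltnW.
have [sz1 sz2] := size_wpoly (m - i).
rewrite /basis_re /basis_im !ev_xmonom // -!rmorph_homog.
by rewrite rmorphM rmorphB !rmorphM !rmorphXn.
Qed.

End Tensor.

End Basis.

(** * Linear independence of the weight basis *)

Section Span.
Variables (k : fieldType) (a b : k) (m : nat).
Hypotheses (two_neq0 : 2%:R != 0 :> k) (a_neq0 : a != 0) (b_neq0 : b != 0) (m_gt0 : (0 < m)%N).

Let row_basis (l : nat) : 'rV[k]_(m.*2.+1) :=
  if (l < m)%N then basis_re a b m l else if l == m then basis_mid a b m
  else basis_im a b m (m.*2 - l).

(* Over [k(sqrt a)] the conic is parametrized by [x = u], [y + sqrt a z = - (a / b) u^2],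
   [y - sqrt a z = 1]; this separates the weight vectors by their degree in [u]. *)
Lemma basis_free (v : 'I_(m.*2.+1) -> k) :
  \sum_l v l *: row_basis l = 0 -> forall l, v l = 0.
Proof.
move=> v0; pose K := sqext a; pose r : K := sqext_root a.
have [f fE] : exists f : {rmorphism k -> {poly K}}, forall c, f c = (sqext_in a c)%:P.
  by exists (polyC \o @sqext_in _ a).
pose s : {poly K} := r%:P; pose w : {poly K} := f (- (a / b)) * 'X^2.
(* Solution of [y + s z = w], [y - s z = 1], with [1 / s] written as [s / a]. *)
pose y := f (2^-1) * (w + 1); pose z := f ((2 * a)^-1) * s * (w - 1).
have def_s : s ^+ 2 = f a by rewrite fE /s -polyC_exp sqext_rootK.
have f2 : f 2^-1 * 2 = 1 by rewrite -(rmorph_nat f) -rmorphM mulVf ?rmorph1.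
have yDz : y + s * z = w.
  transitivity (f 2^-1 * 2 * w + f 2^-1 * (1 - w) + f (2 * a)^-1 * s ^+ 2 * (w - 1)).
    by rewrite /y /z; ring.
  have -> : f (2 * a)^-1 * s ^+ 2 = f 2^-1.
    by rewrite def_s -rmorphM; congr (f _); field; rewrite two_neq0.
  by rewrite f2; ring.
have yBz : y - s * z = 1.
  transitivity (f 2^-1 * (w + 1) - f (2 * a)^-1 * s ^+ 2 * (w - 1)).
    by rewrite /y /z; ring.
  have -> : f (2 * a)^-1 * s ^+ 2 = f 2^-1.
    by rewrite def_s -rmorphM; congr (f _); field; rewrite two_neq0.
  by rewrite -mulrBr -[RHS]f2; ring.
have Nx : on_conic a b f 'X y z.
  rewrite /on_conic; transitivity (- f a * 'X^2 - f b * ((y + s * z) * (y - s * z))).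
    by rewrite /= -def_s; ring.
  rewrite yDz yBz mulr1 /w mulrA -rmorphM.
  by rewrite (_ : b * _ = - a) ?rmorphN; [ring | field].
have ev_re l : (l < m)%N -> 2 * ev f 'X y z (basis_re a b m l) = 'X^l * (w ^+ (m - l) + 1).
  move=> lt_lm; have [sz _] := size_wpoly a (m - l).
  rewrite ev_xmonom // ?(ltnW lt_lm) //; have [] := homogenize_wpoly y z (m - l) def_s.
  by rewrite yDz yBz expr1n => -> eq1; rewrite [X in _ + X]eq1; ring.
have ev_im l : (l < m)%N -> 2 * s * ev f 'X y z (basis_im a b m l) = 'X^l * (w ^+ (m - l) - 1).
  move=> lt_lm; have [_ sz] := size_wpoly a (m - l).
  rewrite ev_xmonom // ?(ltnW lt_lm) //; have [] := homogenize_wpoly y z (m - l) def_s.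
  by rewrite yDz yBz expr1n => -> eq1; rewrite [X in _ - X]eq1; ring.
pose c l := v (inord l).
(* Multiplying the relation by [2 s] clears the halves and the division by [s]. The real and the
   imaginary vector of index [l] together contribute only in degrees [l] and [2m - l]. *)
have eq0 : \sum_(l < m) 'X^l * ((f (c l) * s - f (c (m.*2 - l)%N))
      + w ^+ (m - l) * (f (c l) * s + f (c (m.*2 - l)%N))) + 2 * s * f (c m) * 'X^m = 0.
  have := congr1 (fun v => 2 * s * ev f 'X y z v) v0.
  rewrite /= ev0 mulr0 ev_sum => sum0; rewrite -[RHS]sum0.
  pose F l := ev f 'X y z (c l *: row_basis l).
  transitivity (2 * s * \sum_(l < m.*2.+1) F l); last first.
    by congr (_ * _); apply: eq_bigr => l _; rewrite /F /c inord_val.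
  rewrite sum_fold mulrDr mulr_sumr; congr (_ + _); last first.
    by rewrite /F evZ /row_basis ltnn eqxx ev_mid // !mulrA.
  apply: eq_bigr => l _; have lt_lm := ltn_ord l.
  rewrite /F !evZ /row_basis lt_lm ltnNge (_ : (m <= m.*2 - l)%N) /=; last by lia.
  rewrite gtn_eqF; last by lia.
  rewrite subKn; last by lia.
  transitivity (f (c l) * s * (2 * ev f 'X y z (basis_re a b m l))
     + f (c (m.*2 - l)%N) * (2 * s * ev f 'X y z (basis_im a b m l))); last by ring.
  by rewrite ev_re // ev_im //; ring.
(* Degrees at most [m] suffice: the coefficient of degree [l < m] has the two unknowns as
   coordinates on [1] and [r], so both vanish. *)
pose lo l := sqext_in a (c l) * r - sqext_in a (c (m.*2 - l)%N).
have coef_lo j : (j <= m)%N ->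
    \sum_(l < m) (lo l * (j == l)%:R) + r * sqext_in a (2 * c m) * (j == m)%:R = 0.
  move=> le_jm; have := congr1 (fun p : {poly K} => p`_j) eq0.
  rewrite coefD coef0 coef_sum => sum0; rewrite -[RHS]sum0; congr (_ + _); last first.
    have -> : 2 * s * f (c m) = (r * sqext_in a (2 * c m))%:P.
      have -> : sqext_in a (2 * c m) = 2 * sqext_in a (c m) by rewrite rmorphM rmorph_nat.
      have C2 : 2%:P = 2 :> {poly K} by rewrite rmorph_nat.
      by rewrite fE /s !polyCM C2; ring.
    by rewrite coefCM coefXn.
  apply: eq_bigr => l _; have lt_lm := ltn_ord l.
  pose hi := (sqext_in a (- (a / b)) ^+ (m - l)
    * (sqext_in a (c l) * r + sqext_in a (c (m.*2 - l)%N))).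
  have -> : 'X^l * (f (c l) * s - f (c (m.*2 - l)%N)
      + w ^+ (m - l) * (f (c l) * s + f (c (m.*2 - l)%N)))
      = (lo l)%:P * 'X^l + hi%:P * 'X^(2 * (m - l) + l).
    rewrite /w exprMn -exprM exprD !fE /lo /hi /s !(polyCM, polyCD, polyCN, polyC_exp); ring.
  rewrite coefD !coefCM !coefXn (_ : (j == 2 * (m - l) + l)%N = false) ?mulr0 ?addr0 //; lia.
have c_lt j : (j < m)%N -> c j = 0 /\ c (m.*2 - j)%N = 0.
  move=> lt_jm; have := coef_lo j (ltnW lt_jm).
  rewrite (bigD1 (Ordinal lt_jm)) //= eqxx mulr1 big1 ?addr0 => [|l ne_l]; last first.
    by rewrite eq_sym (negPf (_ : (l != j :> nat))) ?mulr0.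
  rewrite ltn_eqF // mulr0 addr0 /lo => lo0.
  have : sqext_in a (- c (m.*2 - j)%N) + r * sqext_in a (c j) = 0.
    by rewrite -[RHS]lo0 rmorphN; ring.
  by case/sqext_eq0 => /eqP; rewrite oppr_eq0 => /eqP.
have c_m : c m = 0.
  have := coef_lo m (leqnn m).
  rewrite big1 ?add0r => [|l _]; last by rewrite gtn_eqF ?mulr0.
  rewrite eqxx mulr1 -[_ * _]add0r -(rmorph0 (@sqext_in _ a)) => /sqext_eq0[_ /eqP].
  by rewrite mulf_eq0 (negPf two_neq0) => /eqP.
move=> l; rewrite -[l]inord_val -/(c l).
have [/c_lt[]//|] := ltnP l m; rewrite leq_eqVlt => /predU1P[<- //|lt_ml].
have lt_l : (m.*2 - l < m)%N by have := ltn_ord l; lia.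
have [_] := c_lt _ lt_l; rewrite subKn //; have := ltn_ord l; lia.
Qed.

(** Spanning is phrased through an arbitrary subspace [U], so that later rescalings and changes of
    basis only require membership arguments. *)
Lemma basis_span (U : {vspace 'rV[k]_(m.*2.+1)}) :
  (forall i, (i < m)%N -> basis_re a b m i \in U) ->
  (forall i, (i < m)%N -> basis_im a b m i \in U) ->
  basis_mid a b m \in U -> forall v, v \in U.
Proof.
move=> U_re U_im U_mid v.
pose M : 'M[k]_(m.*2.+1) := \matrix_l row_basis l.
have unitM : M \in unitmx.
  rewrite -row_free_unit; apply: inj_row_free => w w0; apply/rowP => l; rewrite mxE.
  apply: (basis_free (v := fun l => w 0 l)).
  by rewrite -[RHS]w0 mulmx_sum_row; apply: eq_bigr => i _; rewrite rowK.
rewrite -(mulmxKV unitM v) mulmx_sum_row; apply: memv_suml => l _.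
rewrite memvZ // rowK /row_basis; case: ltnP => [/U_re //|le_ml].
case: eqP => // /eqP ne_lm; apply: U_im; have := ltn_ord l; lia.
Qed.
End Span.

(** * The Gram matrix *)

Lemma mulmx1C_eq (R : comUnitRingType) (p q : nat) (A : 'M[R]_(p, q)) (B : 'M[R]_(q, p)) :
  p = q -> A *m B = 1%:M -> B *m A = 1%:M.
Proof. by move=> eq_pq; move: A B; rewrite eq_pq => A B /mulmx1C. Qed.

Section Gram.
Variables (k : fieldType) (a b : k) (m : nat).
Hypotheses (a_neq0 : a != 0) (m_gt0 : (0 < m)%N).

(** A tensor that is a weighted sum of squares of vectors has Gram matrix [M^T D M], with the
    vectors as the rows of [M]. They span and their number is the dimension, so [M] is invertible
    and its inverse provides the isometry with [D]. *)
Lemma exists_gram (L : seq (k * 'rV[k]_(m.*2.+1))) :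
  size L = m.*2.+1 ->
  (forall (S : comNzRingType) (f : {rmorphism k -> S}) (x y z x' y' z' : S),
     on_conic a b f x y z -> on_conic a b f x' y' z' ->
     \sum_(l <- L) f l.1 * (ev f x y z l.2 * ev f x' y' z' l.2)
       = polar a b f x y z x' y' z' ^+ m) ->
  (forall v, v \in <<[seq l.2 | l <- L]>>%VS) ->
  exists G : 'M[k]_(m.*2.+1),
    [/\ G^T = G, SLQ_invariant a b G & isometric G (dform [seq l.1 | l <- L])].
Proof.
move=> sz_L tensorL spanL; pose X := [seq l.2 | l <- L]; pose s := [seq l.1 | l <- L].
pose M : 'M[k]_(size s, m.*2.+1) := \matrix_l X`_l.
exists (M^T *m dform s *m M); split.
- by rewrite !trmx_mul trmxK tr_diag_mx mulmxA.
- apply: tensor_invariant => // S f x y z x' y' z' Np Nq; rewrite -tensorL //.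
  set G := _ *m M.
  pose hP : 'rV[S]_(m.*2.+1) := \row_i hval m i x y z.
  pose hQ : 'rV[S]_(m.*2.+1) := \row_i hval m i x' y' z'.
  transitivity ((hP *m map_mx f G *m hQ^T) 0 0).
    by rewrite -sum_mulmx_row; apply: eq_bigr => i _; apply: eq_bigr => j _; rewrite !mxE.
  rewrite /G !map_mxM !mulmxA -(mulmxA _ (map_mx f M)) -map_trmx -[_ *m hQ^T]trmxK trmx_mul trmxK.
  rewrite -sum_mulmx_row (big_nth (0, 0)) big_mkord.
  have sz_s : size s = size L by rewrite size_map.
  transitivity (\sum_(l < size s) f s`_l * (ev f x y z X`_l * ev f x' y' z' X`_l)).
    apply: eq_bigr => l _; rewrite (bigD1 l) //= big1 ?addr0 => [|l' ne_l'l].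
      rewrite !mxE eqxx mulr1n; congr (_ * (_ * _)); apply: eq_bigr => i _;
      by rewrite !mxE mulrC.
    by rewrite !mxE eq_sym (negPf ne_l'l) rmorph0 mul0r.
  rewrite sz_s.
  by apply: eq_bigr => l _; rewrite !(nth_map (0, 0)).
have fullM : row_full M.
  rewrite -sub1mx; apply/row_subP => i; move: (row i _) => v.
  have /coord_span -> : v \in <<in_tuple X>>%VS by apply: spanL.
  apply: summx_sub => l _.
  apply: scalemx_sub; have lt_l : (l < size s)%N by rewrite (leq_trans (ltn_ord l)) // !size_map.
  by rewrite (_ : _`_l = row (Ordinal lt_l) M) ?row_sub // rowK.
have [B BM] := row_fullP fullM.
have MB : M *m B = 1%:M by apply: mulmx1C_eq BM; rewrite size_map.
exists B^T, M^T; rewrite -!trmx_mul MB BM !trmx1; split=> //; split=> //.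
by rewrite trmxK !mulmxA -trmx_mul MB trmx1 mul1mx -mulmxA MB mulmx1.
Qed.

Let J := [seq i <- iota 0 m.*2 | odd i && (i.*2 < m.*2)%N].

Lemma big_odd_lt (V : nmodType) (F : nat -> V) :
  \sum_(i <- J) F i = \sum_(i < m | odd i) F i.
Proof.
rewrite big_filter (_ : iota 0 m.*2 = index_iota 0 m.*2); last by rewrite /index_iota subn0.
rewrite -(big_mkord (fun i => odd i) F) (@big_nat_widen _ _ _ 0 m m.*2); last by lia.
by apply: eq_bigl => i; rewrite ltn_double.
Qed.

Lemma sum_odd_const c n : (\sum_(i < n | odd i) c = n./2 * c)%N.
Proof.
elim: n => [|n IHn]; first by rewrite big_ord0.
by rewrite big_mkcond big_ord_recr -big_mkcond /= IHn; case: ifP; rewrite ?uphalf_half /=; lia.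
Qed.

(** Bookkeeping for [target_form]: the four vectors attached to an odd [i < m] carry one scaled copy
    of the norm form, and [T] carries the summand with the central binomial. *)
Lemma exists_gram_target (X1 X2 X3 X4 : nat -> 'rV[k]_(m.*2.+1)) (T : seq (k * 'rV[k]_(m.*2.+1))) :
  [seq l.1 | l <- T] = (if ~~ odd m then bf1 ('C(m.*2, m))%:R
                        else bftens (bf1 ('C(m.*2, m))%:R) (normQ' a b)) ->
  (forall (S : comNzRingType) (f : {rmorphism k -> S}) (x y z x' y' z' : S),
     on_conic a b f x y z -> on_conic a b f x' y' z' ->
     let E v := ev f x y z v * ev f x' y' z' v in
     \sum_(i < m | odd i) f (2 * 'C(m.*2, i)%:R) *
        (E (X1 i) - f a * E (X2 i) - f b * E (X3 i) + f (a * b) * E (X4 i))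
     + \sum_(l <- T) f l.1 * E l.2
       = polar a b f x y z x' y' z' ^+ m) ->
  (forall U : {vspace 'rV[k]_(m.*2.+1)},
     (forall i, (i < m)%N -> odd i -> [/\ X1 i \in U, X2 i \in U, X3 i \in U & X4 i \in U]) ->
     (forall l, l \in T -> l.2 \in U) -> forall v, v \in U) ->
  exists G : 'M[k]_(m.*2.+1),
    [/\ G^T = G, SLQ_invariant a b G & isometric G (dform (target_form a b m.*2))].
Proof.
move=> def_T tensorT spanT.
pose c i : k := 'C(m.*2, i)%:R.
pose L := flatten [seq [:: (2 * (c i * 1), X1 i); (2 * (c i * - a), X2 i);
                          (2 * (c i * - b), X3 i); (2 * (c i * (a * b)), X4 i)] | i <- J] ++ T.
have dvd4 : (4 %| m.*2)%N = ~~ odd m by lia.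
have -> : target_form a b m.*2 = [seq l.1 | l <- L].
  rewrite /L map_cat def_T /target_form dvd4 doubleK; congr (_ ++ _).
  rewrite /phi_odd -/J; elim: (J) => //= i I IHI.
  by rewrite -IHI /bftens /= !cats0.
apply: exists_gram.
(* There are [m./2] odd indices below [m]; four vectors for each, plus one for [m] even or three for
   [m] odd, make [2m + 1]. *)
- rewrite /L size_cat -(size_map fst T) def_T size_flatten /shape -map_comp.
  rewrite sumnE big_map big_odd_lt /= sum_odd_const.
  by case: (boolP (odd m)) => odd_m /=; lia.
- move=> S f x y z x' y' z' Np Nq; rewrite -tensorT // /L big_cat big_flatten big_map big_odd_lt.
  congr (_ + _); apply: eq_bigr => i _; rewrite !big_cons big_nil /= /c.
  by rewrite !rmorphM !rmorphN !rmorph1 !rmorph_nat; ring.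
apply: spanT => [i lt_im odd_i|l Tl]; last first.
  by rewrite memv_span // /L map_cat mem_cat (map_f snd Tl) orbT.
have Ji : i \in J by rewrite mem_filter odd_i ltn_double lt_im mem_iota /=; lia.
have memL p : p \in [:: (2 * (c i * 1), X1 i); (2 * (c i * - a), X2 i);
     (2 * (c i * - b), X3 i); (2 * (c i * (a * b)), X4 i)] -> p.2 \in <<[seq l.2 | l <- L]>>%VS.
  move=> pi; rewrite memv_span // map_f // mem_cat; apply/orP; left.
  by apply/flattenP; eexists; [apply: map_f Ji | exact: pi].
split.
- by apply: (memL (2 * (c i * 1), X1 i)); rewrite !inE eqxx.
- by apply: (memL (2 * (c i * - a), X2 i)); rewrite !inE eqxx !orbT.
- by apply: (memL (2 * (c i * - b), X3 i)); rewrite !inE eqxx !orbT.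
by apply: (memL (2 * (c i * (a * b)), X4 i)); rewrite !inE eqxx !orbT.
Qed.
End Gram.

(** * Passage to odd indices and assembly of the form *)

Section Final.
Variables (k : fieldType) (a b : k) (m : nat).
Hypotheses (two_neq0 : 2%:R != 0 :> k) (a_neq0 : a != 0) (b_neq0 : b != 0) (m_gt0 : (0 < m)%N).

(** Once both sides are expanded, the coefficient of [P i * Q l] is the one computed in
    [odd_of_even_isom]. *)
Lemma odd_of_even_tensor (S : comNzRingType) (f : {rmorphism k -> S}) (P Q : nat -> S) :
  let PF j := \sum_(i < m | ~~ odd i) f (odd_of_even k m j i) * P i in
  let QF j := \sum_(i < m | ~~ odd i) f (odd_of_even k m j i) * Q i in
  \sum_(j < m | odd j) f (2 * 'C(m.*2, j)%:R) * (PF j * QF j)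
    + (if odd m then f 'C(m.*2, m)%:R * (PF m * QF m) else 0)
  = \sum_(i < m | ~~ odd i) f (2 * 'C(m.*2, i)%:R) * (P i * Q i).
Proof.
move=> PF QF; pose N := odd_of_even k m.
have PQF c j : f c * (PF j * QF j) =
    \sum_(i < m | ~~ odd i) \sum_(l < m | ~~ odd l) f (c * (N j i * N j l)) * (P i * Q l).
  rewrite mulr_suml mulr_sumr; apply: eq_bigr => i _.
  rewrite mulr_sumr mulr_sumr; apply: eq_bigr => l _; rewrite !rmorphM; ring.
pose top i l := if odd m then 'C(m.*2, m)%:R * (N m i * N m l) else 0.
transitivity (\sum_(i < m | ~~ odd i) \sum_(l < m | ~~ odd l)
    f (\sum_(j < m | odd j) 2 * 'C(m.*2, j)%:R * (N j i * N j l) + top i l) * (P i * Q l)).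
  have -> : (if odd m then f 'C(m.*2, m)%:R * (PF m * QF m) else 0) =
     \sum_(i < m | ~~ odd i) \sum_(l < m | ~~ odd l) f (top i l) * (P i * Q l).
    rewrite /top; case: (odd m); first exact: PQF.
    by rewrite big1 // => i _; rewrite big1 // => l _; rewrite rmorph0 mul0r.
  under eq_bigr do rewrite PQF.
  rewrite exchange_big -big_split; apply: eq_bigr => i _ /=.
  rewrite exchange_big -big_split; apply: eq_bigr => l _ /=.
  by rewrite rmorphD rmorph_sum mulrDl mulr_suml.
apply: eq_bigr => i ev_i; rewrite (bigD1 i) //= [X in _ + X]big1 ?addr0 => [|l /andP[ev_l ne_li]].
  by rewrite odd_of_even_isom // eqxx.
by rewrite odd_of_even_isom // eq_sym (negPf (_ : (l != i :> nat))) ?rmorph0 ?mul0r.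
Qed.

Let to_odd (t : nat -> 'rV[k]_(m.*2.+1)) (j : nat) : 'rV[k]_(m.*2.+1) :=
  \sum_(i < m | ~~ odd i) odd_of_even k m j i *: t i.

(** The original vectors are recovered through [even_of_odd], so replacing even indices by odd ones
    loses nothing of the span. *)
Lemma mem_to_odd (U : {vspace 'rV[k]_(m.*2.+1)}) t i :
  (forall j, (j < m)%N -> odd j -> to_odd t j \in U) -> (odd m -> to_odd t m \in U) ->
  (i < m)%N -> ~~ odd i -> t i \in U.
Proof.
move=> U_lt U_m lt_im ev_i; pose E := even_of_odd k m i.
suff -> : t i = \sum_(j < m | odd j) E j *: to_odd t j + (if odd m then E m *: to_odd t m else 0).
  rewrite memvD //; last by case: ifP => [/U_m/memvZ|_]; rewrite ?mem0v.
  by apply: memv_suml => j odd_j; rewrite memvZ ?U_lt.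
pose top l := if odd m then E m * odd_of_even k m m l else 0.
transitivity (\sum_(l < m | ~~ odd l)
   (\sum_(j < m | odd j) E j * odd_of_even k m j l + top l) *: t l).
  rewrite (bigD1 (Ordinal lt_im)) //= [X in _ + X]big1 ?addr0 => [|l /andP[ev_l ne_li]].
    by rewrite even_of_oddK // eqxx scale1r.
  by rewrite even_of_oddK // eq_sym (negPf (_ : (l != i :> nat))) ?scale0r.
under eq_bigr do rewrite scalerDl scaler_suml.
rewrite big_split exchange_big; congr (_ + _).
  apply: eq_bigr => j _; rewrite scaler_sumr; apply: eq_bigr => l _.
  by rewrite scalerA.
rewrite /top; case: ifP => _; last by rewrite big1 // => l _; rewrite scale0r.
by rewrite scaler_sumr; apply: eq_bigr => l _; rewrite scalerA.
Qed.

(* Rescaled so that only the square classes of [a] and [b] survive in the Gram matrix. *)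
Let re' i := (a ^+ i./2 * b ^+ (m - i)./2) *: basis_re a b m i.
Let im' i := (a ^+ uphalf i * b ^+ (m - i)./2) *: basis_im a b m i.
Let mid' := a ^+ m./2 *: basis_mid a b m.

Let expr_half (c : k) i : c ^+ i = c ^+ odd i * (c ^+ i./2 * c ^+ i./2).
Proof. by rewrite -!exprD addnn odd_double_half. Qed.

Lemma scaled_basis_span (U : {vspace 'rV[k]_(m.*2.+1)}) :
  (forall i, (i < m)%N -> re' i \in U /\ im' i \in U) -> mid' \in U -> forall v, v \in U.
Proof.
have scaleU c v : c != 0 -> c *: v \in U -> v \in U.
  by move=> c_neq0 /(memvZ c^-1); rewrite scalerA mulVf // scale1r.
move=> U_lt U_mid; apply: (@basis_span k a b m) => // [i /U_lt[+ _]|i /U_lt[_]|].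
- by apply: scaleU; rewrite mulf_neq0 ?expf_neq0.
- by apply: scaleU; rewrite mulf_neq0 ?expf_neq0.
by apply: scaleU U_mid; rewrite expf_neq0.
Qed.

Section Tensor.
Variables (S : comNzRingType) (f : {rmorphism k -> S}) (x y z x' y' z' : S).
Hypotheses (Np : on_conic a b f x y z) (Nq : on_conic a b f x' y' z').
Local Notation E v := (ev f x y z v * ev f x' y' z' v).
Local Notation wsum P h := (\sum_(i < m | P i) f (2 * 'C(m.*2, i)%:R) * E (h i)).

Let EZ c (v : 'rV[k]_(m.*2.+1)) : E (c *: v) = f c ^+ 2 * E v.
Proof. by rewrite !evZ; ring. Qed.

Lemma tensor_to_odd t :
  wsum odd (to_odd t) + (if odd m then f 'C(m.*2, m)%:R * E (to_odd t m) else 0)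
  = wsum (fun i => ~~ odd i) t.
Proof.
rewrite -(@odd_of_even_tensor S f (fun i => ev f x y z (t i)) (fun i => ev f x' y' z' (t i))).
have evF j p1 p2 p3 : ev f p1 p2 p3 (to_odd t j)
    = \sum_(i < m | ~~ odd i) f (odd_of_even k m j i) * ev f p1 p2 p3 (t i).
  by rewrite ev_sum; apply: eq_bigr => i _; rewrite evZ.
congr (_ + _); last by rewrite !evF.
by apply: eq_bigr => j _; rewrite !evF.
Qed.

(** The rescaling absorbs all squares, leaving [b] to the parity of [m - i]. For odd [i] the
    rounding up in [im'] adds one more [a] than in [re'], so the factor [a] moves from the imaginary
    to the real term. *)
Let termE i : (i <= m)%N ->
  f (2 * (-1) ^+ m * a ^+ i * b ^+ (m - i) * 'C(m.*2, i)%:R)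
     * (E (basis_re a b m i) - f a * E (basis_im a b m i))
  = f (2 * 'C(m.*2, i)%:R) * (f ((-1) ^+ m * b ^+ (odd m (+) odd i)) *
     (if odd i then f a * E (re' i) - E (im' i) else E (re' i) - f a * E (im' i))).
Proof.
move=> le_im; rewrite /re' /im' !EZ uphalf_half (expr_half a i) (expr_half b (m - i)) oddB //.
by case: (odd i); case: (odd m); rewrite /= ?expr0 ?expr1 ?exprS !rmorphM ?rmorph1; ring.
Qed.

Lemma tensor_scaled :
  f ((-1) ^+ m * b ^+ odd m) * (wsum (fun i => ~~ odd i) re' - f a * wsum (fun i => ~~ odd i) im')
  + f ((-1) ^+ m * b ^+ (~~ odd m)) * (f a * wsum odd re' - wsum odd im')
  + f ((-1) ^+ m * a ^+ odd m * 'C(m.*2, m)%:R) * E mid'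
  = polar a b f x y z x' y' z' ^+ m.
Proof.
set top := f _ * E mid'; rewrite !mulr_sumr -!sumrB !mulr_sumr {}/top.
rewrite -(@tensor_basis k a b m) // [in RHS](bigID (fun i : 'I_m => odd i)) /=.
rewrite [X in _ = X + _]addrC.
rewrite /mid' EZ [in RHS](expr_half a m); congr (_ + _ + _).
- apply: eq_bigr => i ev_i; rewrite termE ?(ltnW (ltn_ord i)) //.
  by rewrite (negPf ev_i) addbF /=; ring.
- apply: eq_bigr => i odd_i; rewrite termE ?(ltnW (ltn_ord i)) //.
  by rewrite odd_i addbT /=; ring.
by rewrite !rmorphM; ring.
Qed.

End Tensor.

Lemma sum_distr4 (S : comNzRingType) (I : finType) (P : pred I) (A B C : S) (g u v w t : I -> S) :
  \sum_(i | P i) g i * (u i - A * v i - B * w i + C * t i)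
  = \sum_(i | P i) g i * u i - A * (\sum_(i | P i) g i * v i)
    - B * (\sum_(i | P i) g i * w i) + C * (\sum_(i | P i) g i * t i).
Proof.
rewrite !mulr_sumr -!sumrB -big_split; apply: eq_bigr => i _ /=; ring.
Qed.

Lemma form_on_Weyl_module : exists G : 'M[k]_(m.*2.+1),
  [/\ G^T = G, SLQ_invariant a b G & isometric G (dform (target_form a b m.*2))].
Proof.
pose c : k := 'C(m.*2, m)%:R.
case: (boolP (odd m)) => odd_m.
  (* For odd [m] the overall sign is -1: the odd indices give [1] and [-a], the even ones, moved to
     odd, give [-b] and [ab]. The middle vector and the two vectors landing at index [m] make up
     [normQ']. *)
  apply: (@exists_gram_target k a b m a_neq0 m_gt0 im' re' (to_odd re') (to_odd im')
    [:: (c * - a, mid'); (c * - b, to_odd re' m); (c * (a * b), to_odd im' m)]).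
  - by rewrite odd_m.
  - move=> S f x y z x' y' z' Np Nq E.
    rewrite -tensor_scaled // -!tensor_to_odd odd_m !big_cons big_nil sum_distr4.
    by rewrite -signr_odd odd_m !rmorphM !rmorphN !rmorph1 -/c /E /=; ring.
  - move=> U U_lt U_T; apply: scaled_basis_span; last by apply: (U_T (_, _) (mem_head _ _)).
    have U_im : to_odd im' m \in U by apply: (U_T (c * (a * b), _)); rewrite !inE eqxx !orbT.
    have U_re : to_odd re' m \in U by apply: (U_T (c * - b, _)); rewrite !inE eqxx !orbT.
    move=> i lt_im; case: (boolP (odd i)) => [odd_i|ev_i]; first by have [] := U_lt i lt_im odd_i.
    by split; apply: mem_to_odd => // j lt_jm odd_j; have [] := U_lt j lt_jm odd_j.
(* For even [m] the roles are exchanged: the moved even indices give [1] and [-a], the odd ones [-b]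
   and [ab], and only the middle vector remains. *)
apply: (@exists_gram_target k a b m a_neq0 m_gt0 (to_odd re') (to_odd im') im' re' [:: (c, mid')]).
- by rewrite odd_m.
- move=> S f x y z x' y' z' Np Nq E.
  rewrite -tensor_scaled // -!tensor_to_odd (negPf odd_m) big_cons big_nil sum_distr4.
  by rewrite -signr_odd (negPf odd_m) !rmorphM !rmorph1 -/c /E /=; ring.
- move=> U U_lt U_T; apply: scaled_basis_span; last by apply: (U_T (_, _) (mem_head _ _)).
  move=> i lt_im; case: (boolP (odd i)) => [odd_i|ev_i]; first by have [] := U_lt i lt_im odd_i.
  by split; apply: mem_to_odd => // [j lt_jm odd_j|odd_m']; [have [] := U_lt j lt_jm odd_j
   | rewrite odd_m' in odd_m | have [] := U_lt j lt_jm odd_j | rewrite odd_m' in odd_m].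
Qed.
End Final.

Theorem theoremA (k : fieldType) (a b : k) (n : nat) :
  2%:R != 0 :> k -> a != 0 -> b != 0 ->
  (0 < n)%N -> ~~ odd n ->
  exists G : 'M[k]_((n./2).*2.+1),
    [/\ G^T = G, SLQ_invariant a b G & isometric G (dform (target_form a b n))].
Proof.
move=> two_neq0 a_neq0 b_neq0 n_gt0 ev_n.
have -> : target_form a b n = target_form a b n./2.*2 by rewrite even_halfK.
by apply: form_on_Weyl_module => //; lia.
Qed.
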